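(* Let $0<q<1$, let $n\ge1$, let $a_1,\dots,a_n$ be non-negative integers, and put $|A|=\sum_ja_j$, $A^k=\sum_{j>k}a_j$. Consider $$N=E_{q^4}(-q^4x_n^2)\,x_n^{a_n}\cdots E_{q^4}(-q^4x_1^2)\,x_1^{a_1}\in\mathcal A$$ (factors in decreasing order of the index). Let $\sigma=\mathrm{id}$ and $\gamma_k=q^{\,k-1+A^k}$ for $k=1,\dots,n$. Then the weak braided Fourier transform $F''(\sigma,\gamma)$ is defined on $N$ and $$F''(\sigma,\gamma)(N)=q^{\sum_j(a_j^2-a_j)}\,i^{|A|}\,b_{q^2}^{\,n}\,q^{\binom n2}\ \prod_{j=n}^{1}\tilde h_{a_j}(\partial_j;q^2)\,e_{q^4}(-\partial_j^2)\in\mathcal D,$$ where the product is taken in decreasing order of $j$ (factor $j=n$ leftmost) and $b_{q^2}=(1-q^2)(q^2;q^2)_\infty(-q^2;q^2)_\infty(-1;q^2)_\infty$.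
   Context: Algebras. $\mathcal A$ is the complex algebra of formal power series in $x_1,\dots,x_n$ with relations $x_ix_j=q\,x_jx_i$ for $i>j$; every element is uniquely $\sum_{e}c_e\,x_1^{e_1}\cdots x_n^{e_n}$. $\mathcal D$ is the complex algebra of formal power series in $\partial_1,\dots,\partial_n$ with relations $\partial_i\partial_j=q\,\partial_j\partial_i$ for $i<j$; every element is uniquely $\sum_e c_e\,\partial_n^{e_n}\cdots\partial_1^{e_1}$. For $f=\sum_e c_e x_1^{e_1}\cdots x_n^{e_n}\in\mathcal A$ put $f_{\cdot1}(z)=\sum_e c_ez_1^{e_1}\cdots z_n^{e_n}$ (commuting variables). $q$-notation. $(a;p)_k=\prod_{l=0}^{k-1}(1-ap^l)$, $(a;p)_\infty=\prod_{l\ge0}(1-ap^l)$; $e_p(z)=\sum_{k\ge0}z^k/(p;p)_k$; $E_p(z)=\sum_{k\ge0}p^{k(k-1)/2}z^k/(p;p)_k$; discrete $q^2$-Hermite II polynomials $$\tilde h_l(z;q^2)=(q^2;q^2)_l\sum_{k=0}^{\lfloor l/2\rfloor}\frac{(-1)^kq^{-4kl+2k(2k+1)}z^{l-2k}}{(q^4;q^4)_k\,(q^2;q^2)_{l-2k}} .$$ Lattice order integral. Let $\sigma\in S_n$, $\gamma\in\mathbb R_{>0}^n$. For a power series $\varphi$ in commuting variables $z_i$, $i\in S\subseteq\{1,\dots,n\}$, and $l\in S$, let $\varphi^{ev}$ be the part of $\varphi$ with all exponents even, and define the function $\int_l\varphi$ of the variables $z_i$, $i\in S\setminus\{l\}$,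 by $$\Big(\int_l\varphi\Big)(z)=(1-q^2)\sum_{h\in\mathbb Z}\ \sum_{\varepsilon=\pm1}q^{2h}\gamma_l\ \varphi^{ev}(w),\qquad w_i=q^{-1}z_i\ (i<l),\quad w_l=\varepsilon q^{2h}\gamma_l,\quad w_i=z_i\ (i>l)$$ (with $\varphi^{ev}$ analytically extended where needed). An element $f\in\mathcal A$ with $f_{\cdot1}$ absolutely convergent near $0$ is lattice order integrable for $(\sigma,\gamma)$ if, setting $\varphi_0=f_{\cdot1}$ and $\varphi_k=\int_{\sigma(k)}\varphi_{k-1}$, each $\varphi_k$ ($k=1,\dots,n$) is given by an absolutely convergent series and is an entire function of the remaining variables; then $I''_{(\sigma,\gamma)}f:=\varphi_n\in\mathbb C$. Weak transform. If $f\,x_1^{e_1}\cdots x_n^{e_n}$ is lattice order integrable for $(\sigma,\gamma)$ for all $e\in\mathbb Z_{\ge0}^n$, then, with $|E|=\sum_je_j$, $$F''(\sigma,\gamma)(f)=\sum_{e\in\mathbb Z_{\ge0}^n}I''_{(\sigma,\gamma)}\big(f\,x_1^{e_1}\cdots x_n^{e_n}\big)\ \frac{i^{|E|}\,q^{-\sum_j(j-1)e_j}}{\prod_j(q^2;q^2)_{e_j}}\ \partial_n^{e_n}\cdots\partial_1^{e_1}\in\mathcal D .$$ *)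

(* Defs.v *)
From HB Require Import structures.
From mathcomp Require Import all_boot all_order all_algebra all_fingroup.
From mathcomp Require Import finmap.
From mathcomp Require Import boolp classical_sets functions reals topology.
From mathcomp Require Import normedtype sequences.
From mathcomp Require Import summability.
From mathcomp Require Export complex.
Export boolp classical_sets reals.
Export numFieldNormedType.Exports.
Set Implicit Arguments.
Unset Strict Implicit.
Unset Printing Implicit Defensive.
Import Order.TTheory GRing.Theory Num.Theory.
Local Open Scope classical_set_scope.
Local Open Scope ring_scope.

(* Throughout, C is the field of complex numbers (instantiated to R[i] with
   R : realType), and indices are shifted by one: the usual 1, .., n are the elements
   0, .., n-1 of 'I_n. *)

Definition qpoch (C : numClosedFieldType) (a p : C) (k : nat) : C :=
  \prod_(l < k) (1 - a * p ^+ l).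

Definition qpoch_inf (C : numClosedFieldType) (a p : C) : C :=
  lim (qpoch a p k @[k --> \oo]).

Definition e_coef (C : numClosedFieldType) (p : C) (k : nat) : C :=
  (qpoch p p k)^-1.

Definition E_coef (C : numClosedFieldType) (p : C) (k : nat) : C :=
  p ^+ 'C(k, 2) / qpoch p p k.

(* htilde_l(z; p), so that the exponent -4kl + 2k(2k+1) of q for p = q^2 is the
   exponent -2kl + k(2k+1) of p *)
Definition dhermite2 (C : numClosedFieldType) (p : C) (l : nat) : {poly C} :=
  qpoch p p l *:
    \sum_(k < l./2.+1)
      ((-1) ^+ k * p ^ (- (2 * k * l)%:Z + (k * (2 * k + 1))%:Z)
        / (qpoch (p ^+ 2) (p ^+ 2) k * qpoch p p (l - 2 * k)%N))
      *: 'X^(l - 2 * k).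

Definition b_const (C : numClosedFieldType) (p : C) : C :=
  (1 - p) * qpoch_inf p p * qpoch_inf (- p) p * qpoch_inf (-1) p.

Notation mexp n := {ffun 'I_n -> nat}.

Definition mexp0 (n : nat) : mexp n := [ffun=> 0%N].

(* An element of either algebra is its family of coefficients (c_e) in the
   normally ordered monomials: x_1^{e_1} ... x_n^{e_n} in the algebra A, and
   d_n^{e_n} ... d_1^{e_1} in the algebra D. The same families are used for
   power series in commuting variables, so that f |-> f_{.1} is the identity. *)
Definition qseries (C : numClosedFieldType) (n : nat) := mexp n -> C.

(* The powers of q produced when the product of two normally ordered monomials
   is normally ordered: x^e x^d = q^(twistA e d) x^(e + d) since
   x_i x_j = q x_j x_i for j < i, and d^e d^d = q^(twistD e d) d^(e + d) since
   d_i d_j = q d_j d_i for i < j. *)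
Definition twistA (n : nat) (e d : mexp n) : nat :=
  (\sum_(i < n) \sum_(j < n | (j < i)%N) e i * d j)%N.

Definition twistD (n : nat) (e d : mexp n) : nat :=
  (\sum_(i < n) \sum_(j < n | (i < j)%N) e i * d j)%N.

Definition twisted_mul (C : numClosedFieldType) (n : nat)
    (t : mexp n -> mexp n -> nat) (q : C) (f g : qseries C n) : qseries C n :=
  fun e => \sum_(d : {dffun forall i : 'I_n, 'I_(e i).+1})
    let d1 : mexp n := [ffun i => nat_of_ord (d i)] in
    let d2 : mexp n := [ffun i => (e i - d i)%N] in
    q ^+ t d1 d2 * f d1 * g d2.

Definition mulA (C : numClosedFieldType) (n : nat) (q : C) :=
  @twisted_mul C n (@twistA n) q.

Definition mulD (C : numClosedFieldType) (n : nat) (q : C) :=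
  @twisted_mul C n (@twistD n) q.

Definition monomial (C : numClosedFieldType) (n : nat) (d : mexp n) :
  qseries C n := fun e => (e == d)%:R.

Definition qone (C : numClosedFieldType) (n : nat) : qseries C n :=
  monomial C (mexp0 n).

(* \sum_k (g k) X_j^k, for X_j the j-th generator of either algebra *)
Definition in_gen (C : numClosedFieldType) (n : nat) (j : 'I_n)
    (g : nat -> C) : qseries C n :=
  fun e => if [forall i, (i != j) ==> (e i == 0%N)] then g (e j) else 0.

(* coefficients of \sum_k (g k) (c u^2)^k as a series in u *)
Definition subst_sq (C : numClosedFieldType) (g : nat -> C) (c : C)
    (m : nat) : C :=
  if odd m then 0 else g m./2 * c ^+ m./2.

Definition gaussN (C : numClosedFieldType) (n : nat) (q : C)
    (a : 'I_n -> nat) : qseries C n :=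
  \big[mulA q/@qone C n]_(j <- rev (enum 'I_n))
    mulA q (in_gen j (subst_sq (E_coef (q ^+ 4)) (- q ^+ 4)))
           (in_gen j (fun k => (k == a j)%:R)).

Definition hermite_gauss_prod (C : numClosedFieldType) (n : nat) (q : C)
    (a : 'I_n -> nat) : qseries C n :=
  \big[mulD q/@qone C n]_(j <- rev (enum 'I_n))
    mulD q (in_gen j (fun k => (dhermite2 (q ^+ 2) (a j))`_k))
           (in_gen j (subst_sq (e_coef (q ^+ 4)) (-1))).

Definition abs_sum (C : numClosedFieldType) (I : choiceType) (x : I -> C)
    (s : C) : Prop :=
  (exists M : C, forall J : {fset I}, partial_sum (fun i => `|x i|) J <= M) /\
  (partial_sum x J @[J --> totally] --> s).

Definition monom_at (C : numClosedFieldType) (n : nat) (z : 'rV[C]_n)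
    (e : mexp n) : C := \prod_(i < n) z 0 i ^+ e i.

Definition psum_at (C : numClosedFieldType) (n : nat) (c : qseries C n)
    (z : 'rV[C]_n) (v : C) : Prop :=
  abs_sum (fun e => c e * monom_at z e) v.

Definition analytic_on (C : numClosedFieldType) (n : nat) (U : set 'rV[C]_n)
    (g : 'rV[C]_n -> C) : Prop :=
  forall p, U p ->
    exists c : qseries C n, \forall z \near p, psum_at c (z - p) (g z).

Definition analytic_extension (C : numClosedFieldType) (n : nat)
    (c : qseries C n) (U : set 'rV[C]_n) (g : 'rV[C]_n -> C) : Prop :=
  [/\ open U, connected U, U 0, analytic_on U g &
      \forall z \near (0 : 'rV[C]_n), psum_at c z (g z)].

(* v is the value at w of the analytic extension of c: some extension is defined
   at w, and all those that are take the value v there (no monodromy). *)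
Definition extended_value (C : numClosedFieldType) (n : nat)
    (c : qseries C n) (w : 'rV[C]_n) (v : C) : Prop :=
  unique (fun v' => exists U g,
            [/\ analytic_extension c U g, U w & g w = v']) v.

Definition even_part (C : numClosedFieldType) (n : nat) (c : qseries C n) :
    qseries C n :=
  fun e => if [forall i, ~~ odd (e i)] then c e else 0.

(* the point w for p = (h, b), where epsilon = (-1)^b *)
Definition lattice_point (C : numClosedFieldType) (n : nat) (q : C)
    (gam : 'I_n -> C) (l : 'I_n) (z : 'rV[C]_n) (p : int * bool) : 'rV[C]_n :=
  \row_i (if (i < l)%N then q^-1 * z 0 i
          else if i == l then (-1) ^+ p.2 * q ^ (2 * p.1) * gam l
          else z 0 i).

(* F is the function \int_l c, given by an absolutely convergent sum at every
   point; a function of some of the variables is viewed as a function of all of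
   them. *)
Definition is_lattice_integral (C : numClosedFieldType) (n : nat) (q : C)
    (gam : 'I_n -> C) (l : 'I_n) (c : qseries C n) (F : 'rV[C]_n -> C) : Prop :=
  forall z, exists2 g : int * bool -> C,
    forall p, extended_value (even_part c) (lattice_point q gam l z p) (g p) &
    abs_sum (fun p => (1 - q ^+ 2) * (q ^ (2 * p.1) * gam l * g p)) (F z).

Definition series_in (C : numClosedFieldType) (n : nat) (S : {set 'I_n})
    (c : qseries C n) : Prop :=
  forall (e : mexp n) i, i \notin S -> e i != 0%N -> c e = 0.

Definition entire_series (C : numClosedFieldType) (n : nat) (c : qseries C n)
    (F : 'rV[C]_n -> C) : Prop := forall z, psum_at c z (F z).

Definition lattice_chain (C : numClosedFieldType) (n : nat) (q : C)
    (sigma : 'S_n) (gam : 'I_n -> C) (phi : nat -> qseries C n) : Prop :=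
  (\forall z \near (0 : 'rV[C]_n), exists v, psum_at (phi 0%N) z v) /\
  forall k : 'I_n,
    series_in (~: [set sigma j | j : 'I_n & (j <= k)%N]) (phi k.+1) /\
    exists2 F, is_lattice_integral q gam (sigma k) (phi k) F
             & entire_series (phi k.+1) F.

Definition lattice_value (C : numClosedFieldType) (n : nat) (q : C)
    (sigma : 'S_n) (gam : 'I_n -> C) (f : qseries C n) (v : C) : Prop :=
  exists phi : nat -> qseries C n,
    [/\ phi 0%N = f, lattice_chain q sigma gam phi & phi n (mexp0 n) = v].

Definition lattice_integrable (C : numClosedFieldType) (n : nat) (q : C)
    (sigma : 'S_n) (gam : 'I_n -> C) (f : qseries C n) : Prop :=
  exists v, lattice_value q sigma gam f v.

(* junk value 0 when f is not lattice order integrable *)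
Definition lattice_int (C : numClosedFieldType) (n : nat) (q : C)
    (sigma : 'S_n) (gam : 'I_n -> C) (f : qseries C n) : C :=
  xget 0 [set v | lattice_value q sigma gam f v].

Definition weak_transform_defined (C : numClosedFieldType) (n : nat) (q : C)
    (sigma : 'S_n) (gam : 'I_n -> C) (f : qseries C n) : Prop :=
  forall e : mexp n, lattice_integrable q sigma gam (mulA q f (monomial C e)).

Definition weak_transform (C : numClosedFieldType) (n : nat) (q : C)
    (sigma : 'S_n) (gam : 'I_n -> C) (f : qseries C n) : qseries C n :=
  fun e => lattice_int q sigma gam (mulA q f (monomial C e))
    * ('i ^+ (\sum_(j < n) e j)%N * q ^- (\sum_(j < n) j * e j)%N
        / \prod_(j < n) qpoch (q ^+ 2) (q ^+ 2) (e j)).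

(* Main.v *)
Require Import Defs.
From mathcomp Require Import all_boot all_order all_algebra all_fingroup.
From mathcomp Require Import finmap.
From mathcomp Require Import boolp classical_sets functions reals topology normedtype sequences.
From mathcomp Require Import summability.
From mathcomp Require Import ring lra zify.
Set Implicit Arguments.
Unset Strict Implicit.
Unset Printing Implicit Defensive.
Import Order.TTheory GRing.Theory Num.Theory.
Local Open Scope classical_set_scope.
Local Open Scope ring_scope.

(** Normal ordering turns [N x^e] into a series whose coefficient at
    [x_1^(m_1) .. x_n^(m_n)], with [m_i = a_i + e_i + 2 k_i], is a product of one-variable
    coefficients times a power of [q] coupling the variables.  Summing over [k_l] by Euler's
    identity gives [(q^4 y^2; q^4)_inf] at [y = +- q^(2 N)], because the choice of [gamma_l]
    absorbs the coupling with the variables [i > l] up to a shift of the lattice.  This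
    infinite product vanishes for [N < 0], so the lattice sum is a [q]-Gaussian moment
    [b (q^2; q^4)_(s/2)], [s = a_l + e_l], times a power of [q] of the same shape as before:
    integrating out one variable reproduces the same kind of series in the remaining ones.
    The values along the lattice are those of an entire function, so the identity theorem
    makes the analytic extensions, and then the whole chain of integrals, unique.  Finally the
    moments match the coefficients of [htilde_a(d) e_(q^4)(-d^2)] by a recurrence in [a]
    that is the backward shift of the discrete [q]-Hermite polynomials. *)

(** * Unordered sums *)

Section UnorderedSums.
Variable C : numFieldType.

(** Power series are indexed by multi-exponents and the lattice by [int * bool], so all sums are
    taken unordered, along the finite subsets of an arbitrary index type. One exchange theorem then
    serves both for recentring a power series and for moving the lattice sum past it. The field [C]
    is an arbitrary [numClosedFieldType], not assumed complete or archimedean; completeness and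
    connectedness enter as the hypotheses [sum_complete] and [row_connected], which are established
    for [R[i]]. Exhibiting a chain of integrals is only half of the claim: [lattice_int] selects a
    value by choice and [extended_value] demands that all extensions agree. This is what forces the
    uniqueness of coefficients and the identity theorem to be proved in several variables. *)

Definition hassum (I : choiceType) (x : I -> C) (s : C) : Prop :=
  forall e : C, 0 < e -> exists A : {fset I},
    forall J : {fset I}, (A `<=` J)%fset -> `|\sum_(i <- J) x i - s| < e.

Definition absbounded (I : choiceType) (x : I -> C) : Prop :=
  exists M : C, forall J : {fset I}, \sum_(i <- J) `|x i| <= M.

Lemma ler_sum_fset (I : choiceType) (y : I -> C) (A B : {fset I}) :
  (forall i, 0 <= y i) -> (A `<=` B)%fset ->
  \sum_(i <- A) y i <= \sum_(i <- B) y i.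
Proof.
move=> y0 /fsubsetP AB; rewrite [leRHS](big_fsetID _ (mem A))/=.
rewrite (_ : [fset i in B | i \in A]%fset = A) ?lerDl ?sumr_ge0//.
by apply/fsetP => i; rewrite !inE/=; apply/andb_idl/AB.
Qed.

Lemma sum_fset_seq (I : choiceType) (y : I -> C) (s : seq I) :
  uniq s -> \sum_(i <- [fset i in s]%fset) y i = \sum_(i <- s) y i.
Proof.
move=> us; apply: perm_big; apply: uniq_perm => // i.
by rewrite !inE.
Qed.

Lemma hassum_unique (I : choiceType) (x : I -> C) s t :
  hassum x s -> hassum x t -> s = t.
Proof.
move=> hs ht; apply/eqP/negPn/negP => st.
have d0 : 0 < `|s - t| / 2 by rewrite divr_gt0 ?normr_gt0 ?subr_eq0.
have [A hA] := hs _ d0; have [B hB] := ht _ d0.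
have := hA _ (fsubsetUl A B); have := hB _ (fsubsetUr A B).
set z := \sum_(_ <- _) _ => h1 h2.
have : `|s - t| < `|s - t| / 2 + `|s - t| / 2.
  rewrite (le_lt_trans _ (ltrD h1 h2))// (_ : s - t = (z - t) - (z - s)).
    exact: ler_normB.
  by ring.
by rewrite -splitr ltxx.
Qed.

Lemma hassumD (I : choiceType) (x y : I -> C) s t :
  hassum x s -> hassum y t -> hassum (fun i => x i + y i) (s + t).
Proof.
move=> hs ht e e0; have e2 : 0 < e / 2 by rewrite divr_gt0.
have [A hA] := hs _ e2; have [B hB] := ht _ e2.
exists (A `|` B)%fset => J; rewrite fsubUset => /andP[AJ BJ].
rewrite big_split/= [e]splitr.
rewrite (_ : _ - _ = (\sum_(i <- J) x i - s) + (\sum_(i <- J) y i - t)); last by ring.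
by rewrite (le_lt_trans (ler_normD _ _))// ltrD ?hA ?hB.
Qed.

Lemma hassumZ (I : choiceType) (c : C) (x : I -> C) s :
  hassum x s -> hassum (fun i => c * x i) (c * s).
Proof.
move=> hs e e0.
have c0 : 0 < `|c| + 1 by rewrite ltr_wpDl.
have [A hA] := hs _ (divr_gt0 e0 c0).
exists A => J AJ; rewrite -mulr_sumr -mulrBr normrM.
have := hA _ AJ; rewrite ltr_pdivlMr// mulrC => h.
by rewrite (le_lt_trans _ h)// ler_wpM2r// lerDl.
Qed.

Lemma hassumN (I : choiceType) (x : I -> C) s :
  hassum x s -> hassum (fun i => - x i) (- s).
Proof.
move=> /(hassumZ (-1)); rewrite mulN1r.
by under [X in hassum X]eq_fun do rewrite mulN1r.
Qed.

Lemma hassum_fin (I : choiceType) (x : I -> C) (A : {fset I}) :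
  (forall i, i \notin A -> x i = 0) -> hassum x (\sum_(i <- A) x i).
Proof.
move=> xA e e0; exists A => J AJ.
rewrite (big_fset_incl _ AJ) ?subrr ?normr0// => i _; exact: xA.
Qed.

Lemma hassum0 (I : choiceType) : hassum (fun _ : I => 0) 0.
Proof. by have := @hassum_fin I (fun=> 0) fset0; rewrite big_seq_fset0; apply. Qed.

Lemma hassum_norm_le (I : choiceType) (x : I -> C) s M :
  (forall J : {fset I}, \sum_(i <- J) `|x i| <= M) -> hassum x s -> `|s| <= M.
Proof.
move=> xM hs.
have M0 : 0 <= M by have := xM fset0; rewrite big_seq_fset0.
rewrite real_leNgt ?ger0_real//; apply/negP => Ms.
have [A /(_ A (fsubset_refl _)) hA] := hs (`|s| - M) ltac:(by rewrite subr_gt0).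
have : `|s| < (`|s| - M) + M.
  rewrite (le_lt_trans _ (ltr_leD hA (le_trans (ler_norm_sum _ _ _) (xM A))))//.
  rewrite distrC (_ : s = (s - \sum_(i <- A) x i) + \sum_(i <- A) x i); last by ring.
  rewrite (le_trans (ler_normD _ _))// lerD2r.
  by rewrite (_ : s - \sum_(i <- A) x i + \sum_(i <- A) x i = s); [|ring].
by rewrite subrK ltxx.
Qed.

Lemma absbounded_le (I : choiceType) (x y : I -> C) :
  (forall i, `|x i| <= `|y i|) -> absbounded y -> absbounded x.
Proof. by move=> xy [M hM]; exists M => J; rewrite (le_trans _ (hM J))// ler_sum. Qed.

Lemma absboundedD (I : choiceType) (x y : I -> C) :
  absbounded x -> absbounded y -> absbounded (fun i => x i + y i).
Proof.
move=> [M hM] [N hN]; exists (M + N) => J.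
rewrite (le_trans _ (lerD (hM J) (hN J)))// -big_split ler_sum// => i _.
exact: ler_normD.
Qed.

Lemma absboundedZ (I : choiceType) c (x : I -> C) :
  absbounded x -> absbounded (fun i => c * x i).
Proof.
move=> [M hM]; exists (`|c| * M) => J.
by under eq_bigr do rewrite normrM; rewrite -mulr_sumr ler_wpM2l.
Qed.

Lemma absboundedN (I : choiceType) (x : I -> C) :
  absbounded x -> absbounded (fun i => - x i).
Proof. by apply: absbounded_le => i; rewrite normrN. Qed.

Lemma absbounded_fin (I : choiceType) (x : I -> C) (A : {fset I}) :
  (forall i, i \notin A -> x i = 0) -> absbounded x.
Proof.
move=> xA; exists (\sum_(i <- A) `|x i|) => J.
rewrite (@big_fset_incl _ _ _ _ A (A `|` J)%fset)/= ?fsubsetUl//; last first.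
  by move=> i _ iA; rewrite xA ?normr0.
by rewrite ler_sum_fset// fsubsetUr.
Qed.

Lemma absbounded_inj (I K : choiceType) (f : I -> K) (x : K -> C) :
  injective f -> absbounded x -> absbounded (x \o f).
Proof.
move=> finj [M hM]; exists M => J; rewrite (le_trans _ (hM (f @` J)%fset))//.
by rewrite big_imfset//= => i j _ _; exact: finj.
Qed.

Section Reindex.
Variables (I K : choiceType) (f : I -> K) (g : K -> I) (x : K -> C).
Hypotheses (fK : cancel f g) (x0 : forall k, f (g k) != k -> x k = 0).

Let sum_range (y : K -> C) (J : {fset K}) : (forall k, f (g k) != k -> y k = 0) ->
  \sum_(k <- J) y k = \sum_(i <- [fset g k | k in J & f (g k) == k]%fset) y (f i).
Proof.
move=> y0; rewrite (big_fsetID _ (fun k => f (g k) == k))/= [X in _ + X]big1_fset.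
  rewrite addr0 [RHS]big_imfset/=.
    by rewrite big_fset/= big_filter; apply: eq_bigr => k /eqP ->.
  by move=> k l /andP[_ /eqP kE] /andP[_ /eqP lE] h; rewrite -kE h lE.
by move=> k; rewrite !inE => /andP[_ kE] _; exact: y0.
Qed.

(** Only a left inverse [g] is required, with [x] zero off the range of [f]. This covers
    permutations of the indices as well as embeddings whose omitted terms vanish: the naturals in
    [int], the increment of an exponent, the passage from [k] to [r + 2 k]. *)
Lemma hassum_reindex s : hassum x s <-> hassum (x \o f) s.
Proof.
split=> hs e e0; have [A hA] := hs e e0.
  exists (g @` A)%fset => J AJ.
  have : (A `<=` (f @` J) `|` A)%fset by rewrite fsubsetUr.
  move=> /hA; rewrite sum_range//.
  rewrite (_ : [fset g k | k in _ & _]%fset = J)//.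
  apply/fsetP => i; apply/imfsetP/idP => /=.
    move=> [k]; rewrite inE/= inE => /andP[/orP[/imfsetP[j /= jJ ->] _ ->|kA _ ->]].
      by rewrite fK.
    by apply: (fsubsetP AJ); apply: in_imfset.
  move=> iJ; exists (f i); rewrite ?fK// inE/= fK eqxx andbT inE.
  by rewrite in_imfset.
exists (f @` A)%fset => J AJ; rewrite sum_range//; apply: hA.
apply/fsubsetP => i iA; apply/imfsetP; exists (f i); rewrite ?fK//=.
by rewrite !inE/= fK eqxx andbT (fsubsetP AJ)// in_imfset.
Qed.

Lemma absbounded_reindex : absbounded x <-> absbounded (x \o f).
Proof.
split; first by apply: absbounded_inj; exact: can_inj fK.
move=> [M hM]; exists M => J; rewrite sum_range => [|k /x0 ->]; last by rewrite normr0.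
exact: hM.
Qed.
End Reindex.

Lemma sum_fsetX (I K : choiceType) (x : I * K -> C) (A : {fset I}) (r : I -> {fset K}) :
  \sum_(i <- A) \sum_(k <- r i) x (i, k) =
  \sum_(p <- [fset ((i, k) : I * K) | i in A, k in r i]%fset) x p.
Proof. by rewrite big_imfset2//= => -[i k] [j l] _ _ /= [-> ->]. Qed.

(** A finite [J] lies in the product of its two projections, so it is enough to dominate the finite
    sums along each row. *)
Lemma absbounded_prod (I K : choiceType) (x : I * K -> C) (r : I -> C) :
  absbounded r -> (forall i (J : {fset K}), \sum_(k <- J) `|x (i, k)| <= `|r i|) ->
  absbounded x.
Proof.
move=> [M hM] hr; exists M => J.
pose A := [fset p.1 | p in J]%fset; pose B := [fset p.2 | p in J]%fset.
rewrite (le_trans _ (hM A))//.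
rewrite (le_trans _ (ler_sum _ (fun i _ => hr i B)))//.
rewrite (sum_fsetX (fun p => `|x p|) A (fun=> B)).
set P := imfset2 _ _ _ _.
rewrite ler_sum_fset//; apply/fsubsetP => -[i k] ikJ.
apply/imfset2P; exists i => /=; first by apply/imfsetP; exists (i, k).
by exists k => //; apply/imfsetP; exists (i, k).
Qed.

(* Each of the finitely many rows in play is cut off with an error that is small
   relative to their number. *)
Lemma hassum_fubini (I K : choiceType) (x : I * K -> C) (y : I -> C) s :
  hassum x s -> (forall i, hassum (fun k => x (i, k)) (y i)) -> hassum y s.
Proof.
move=> hs hy e e0; have e2 : 0 < e / 2 by rewrite divr_gt0.
have [A0 hA0] := hs _ e2; exists [fset p.1 | p in A0]%fset => J AJ.
have d0 : 0 < e / 2 / (#|` J|.+1)%:R by rewrite divr_gt0.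
have hR i : exists B : {fset K}, [set k | (i, k) \in A0]%fset `<=` [set` B] /\
    `|\sum_(k <- B) x (i, k) - y i| < e / 2 / (#|` J|.+1)%:R.
  have [B hB] := hy i _ d0.
  pose B' := [fset p.2 | p in A0 & p.1 == i]%fset.
  exists (B `|` B')%fset; split; last by apply: hB; rewrite fsubsetUl.
  move=> k /= ikA; rewrite !inE; apply/orP; right.
  by apply/imfsetP; exists (i, k) => //=; rewrite !inE/= ikA eqxx.
pose r i := projT1 (cid (hR i)).
have rP i := projT2 (cid (hR i)).
rewrite (_ : _ - s = (\sum_(i <- J) \sum_(k <- r i) x (i, k) - s)
    - \sum_(i <- J) (\sum_(k <- r i) x (i, k) - y i)); last first.
  by rewrite sumrB; ring.
rewrite (le_lt_trans (ler_normB _ _))// [ltRHS]splitr ltr_leD//.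
  rewrite sum_fsetX hA0//; apply/fsubsetP => -[i k] ikA.
  apply/imfset2P; exists i; first by apply: (fsubsetP AJ); apply/imfsetP; exists (i, k).
  by exists k => //; apply: (rP i).1.
rewrite (le_trans (ler_norm_sum _ _ _))//.
rewrite (le_trans (ler_sum _ (fun i _ => ltW (rP i).2)))//.
rewrite big_const_seq count_predT iter_addr_0 -[leLHS]mulr_natr mulrAC ler_pdivrMr//.
by rewrite ler_pM2l// ler_nat.
Qed.

Lemma absbounded_fubini (I K : choiceType) (x : I * K -> C) (y : I -> C) :
  absbounded x -> (forall i, hassum (fun k => x (i, k)) (y i)) -> absbounded y.
Proof.
move=> [M hM] hy; exists (M + 1) => J.
(* Cutting off each row of [J] with this error costs at most 1 in total, hence the bound [M + 1]. *)
have d0 : 0 < (#|` J|.+1)%:R^-1 :> C by rewrite invr_gt0.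
have hR i : exists B : {fset K}, `|\sum_(k <- B) x (i, k) - y i| < (#|` J|.+1)%:R^-1.
  by have [B hB] := hy i _ d0; exists B; apply: hB.
pose r i := projT1 (cid (hR i)).
have rP i := projT2 (cid (hR i)).
rewrite (@le_trans _ _ (\sum_(i <- J) (\sum_(k <- r i) `|x (i, k)| + (#|` J|.+1)%:R^-1)))//.
  apply: ler_sum => i _; rewrite (_ : y i = \sum_(k <- r i) x (i, k) -
    (\sum_(k <- r i) x (i, k) - y i)); last by ring.
  by rewrite (le_trans (ler_normB _ _))// lerD ?ler_norm_sum// ltW// rP.
rewrite big_split/= lerD//.
  by rewrite (sum_fsetX (fun p => `|x p|)).
rewrite big_const_seq count_predT iter_addr_0 -[leLHS]mulr_natl.
by rewrite ler_pdivrMr// mul1r ler_nat.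
Qed.

Lemma absbounded_nat (x : nat -> C) (M : C) :
  (forall B, \sum_(k < B) `|x k| <= M) -> absbounded x.
Proof.
move=> xM; exists M => J; pose B := (\max_(k <- J) k).+1.
rewrite (le_trans _ (xM B))// -(big_mkord xpredT (fun k => `|x k|)).
rewrite -[leRHS](sum_fset_seq (fun k => `|x k|)) ?iota_uniq//.
rewrite ler_sum_fset//; apply/fsubsetP => k kJ.
apply/imfsetP; exists k => //=; rewrite mem_index_iota ltnS.
by rewrite /= (big_rem k)//= leq_maxl.
Qed.

Lemma ratio_test (x : nat -> C) (r : C) N : 0 <= r < 1 ->
  (forall k, (N <= k)%N -> `|x k.+1| <= r * `|x k|) -> absbounded x.
Proof.
move=> /andP[r0 r1] xr; have r1' : 0 < 1 - r by rewrite subr_gt0.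
apply: (@absbounded_nat _ (\sum_(k < N) `|x k| + `|x N| / (1 - r))) => B.
(* The partial tail plus the geometric majorant of what remains does not increase with [m]. *)
have tail m : \sum_(k < m) `|x (N + k)%N| + `|x (N + m)%N| / (1 - r) <= `|x N| / (1 - r).
  elim: m => [|m IH]; first by rewrite big_ord0 add0r addn0.
  rewrite big_ord_recr/= (le_trans _ IH)// -addrA lerD2l addnS.
  rewrite ler_pdivlMr// mulrDl divfK ?gt_eqF//.
  by rewrite mulrBr mulr1 -addrA gerDl addrC subr_le0 [leRHS]mulrC xr// leq_addr.
have sub m : \sum_(k < B) `|x k| <= \sum_(k < B + m) `|x k|.
  by rewrite big_split_ord/= lerDl sumr_ge0.
rewrite (le_trans (sub N))// addnC big_split_ord/= lerD2l (le_trans _ (tail B))//.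
by rewrite lerDl divr_ge0// ltW.
Qed.

Section BoxSums.
Variable n : nat.

Let mexp_of B (f : {ffun 'I_n -> 'I_B}) : mexp n := [ffun i => nat_of_ord (f i)].

Let box B : {fset mexp n} :=
  [fset e in [seq mexp_of f | f <- enum {ffun 'I_n -> 'I_B}]]%fset.

Let in_box (e : mexp n) B : (forall i, (e i < B)%N) -> e \in box B.
Proof.
move=> eB; rewrite inE; apply/mapP; exists [ffun i => Ordinal (eB i)] => [|].
  by rewrite mem_enum.
by apply/ffunP => i; rewrite !ffunE.
Qed.

Let sum_box (y : 'I_n -> nat -> C) B :
  \sum_(e <- box B) \prod_i y i (e i) = \prod_i \sum_(k < B) y i k.
Proof.
rewrite sum_fset_seq; last first.
  rewrite map_inj_uniq ?enum_uniq// => f g /ffunP fg; apply/ffunP => i; apply/val_inj.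
  by have := fg i; rewrite !ffunE.
rewrite bigA_distr_bigA big_map big_enum/=; apply: eq_bigr => f _.
by apply: eq_bigr => i _; rewrite ffunE.
Qed.

(** Every finite set of exponents lies in a box, and over a box the sum of products factors into a
    product of sums. *)
Lemma sum_prod_le (y : 'I_n -> nat -> C) (M : 'I_n -> C) (J : {fset mexp n}) :
  (forall i k, 0 <= y i k) -> (forall i B, \sum_(k < B) y i k <= M i) ->
  \sum_(e <- J) \prod_i y i (e i) <= \prod_i M i.
Proof.
move=> y0 yM; pose B := (\max_(e <- J) \max_i e i).+1.
apply: (@le_trans _ _ (\sum_(e <- box B) \prod_i y i (e i))).
  apply: ler_sum_fset => [e|]; first exact: prodr_ge0.
  apply/fsubsetP => e eJ; apply: in_box => i; rewrite ltnS.
  rewrite (leq_trans (leq_bigmax i))//.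
  by rewrite (big_rem e)//= leq_maxl.
by rewrite sum_box; apply: ler_prod => i _; rewrite yM sumr_ge0.
Qed.

Lemma absbounded_mexp (y : 'I_n -> nat -> C) :
  (forall i, absbounded (y i)) -> absbounded (fun e : mexp n => \prod_i y i (e i)).
Proof.
move=> yb; pose M i := projT1 (cid (yb i)); exists (\prod_i M i) => J.
rewrite (eq_bigr _ (fun e _ => normr_prod _ _ _)).
apply: (sum_prod_le (y := fun i k => `|y i k|)) => // i B.
have := projT2 (cid (yb i)) [fset k in index_iota 0 B]%fset.
rewrite sum_fset_seq ?iota_uniq//.
by rewrite -(big_mkord xpredT (fun k => `|y i k|)).
Qed.

Lemma hassum_box (y : 'I_n -> nat -> C) B : (forall i k, (B <= k)%N -> y i k = 0) ->
  hassum (fun e : mexp n => \prod_i y i (e i)) (\prod_i \sum_(k < B) y i k).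
Proof.
move=> yB; rewrite -sum_box; apply: hassum_fin => e eB.
have /existsP[i iB] : [exists i, (B <= e i)%N].
  move: eB; apply: contraNT; rewrite negb_exists => /forallP h.
  by apply: in_box => i; rewrite ltnNge.
by rewrite (bigD1 i)//= yB// mul0r.
Qed.
End BoxSums.

End UnorderedSums.

(** * Completeness of the complex numbers *)

Section Completeness.
Variable R : realType.
Local Notation C := R[i].

Let hassum_ge0_real (I : choiceType) (x : I -> R) :
  (forall i, 0 <= x i) -> absbounded x -> exists s, hassum x s.
Proof.
move=> x0 [M hM]; pose S : set R := [set y | exists J : {fset I}, y = \sum_(i <- J) x i].
have Sub : ubound S M.
  by move=> y [J ->]; rewrite (le_trans _ (hM J))// ler_sum// => i _; rewrite ler_norm.
have Ssup : has_sup S by split; [exists 0, fset0; rewrite big_seq_fset0|exists M].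
exists (sup S) => e e0; have [y [A ->] hA] := sup_adherent e0 Ssup.
exists A => J AJ; have hJ : \sum_(i <- J) x i <= sup S by apply: ub_le_sup; [exists M|exists J].
by have := ler_sum_fset x0 AJ; rewrite ler0_norm ?subr_le0//; lra.
Qed.

(** The family is the difference of two nonnegative ones, [x + |x|] and [|x|], whose sums are
    suprema. *)
Let hassum_real (I : choiceType) (x : I -> R) : absbounded x -> exists s, hassum x s.
Proof.
move=> xb; have xa : absbounded (fun i => `|x i|) by apply: absbounded_le xb => i; rewrite normr_id.
have [s hs] := hassum_ge0_real (fun i => normr_ge0 (x i)) xa.
have [|t ht] := hassum_ge0_real _ (absboundedD xb xa).
  by move=> i; have := ler_norm (- x i); rewrite normrN; lra.
exists (t - s); have := hassumD ht (hassumN hs).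
by under [X in hassum X _]eq_fun do rewrite addrK.
Qed.

Let hassum_RtoC (I : choiceType) (x : I -> R) s :
  hassum x s -> hassum (fun i => (x i)%:C%C : C) s%:C%C.
Proof.
move=> hs e e0; have eE : e = (complex.Re e)%:C%C by rewrite RRe_real// gtr0_real.
have e0' : 0 < complex.Re e by move: e0; rewrite eE ltcR.
have [A hA] := hs _ e0'; exists A => J /hA.
by rewrite -raddf_sum/= -rmorphB/= normc_def/= expr0n addr0 sqrtr_sqr eE ltcR.
Qed.

Lemma absbounded_hassum (I : choiceType) (x : I -> C) :
  absbounded x -> exists s, hassum x s.
Proof.
move=> [M hM].
have bd (y : I -> R) : (forall i, `|y i|%:C%C <= `|x i|) -> absbounded y.
  move=> yx; exists (complex.Re M) => J; rewrite -lecR raddf_sum/= RRe_real.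
    by rewrite (le_trans _ (hM J))// ler_sum.
  by rewrite ger0_real// (le_trans _ (hM J))// sumr_ge0.
have [s hs] := hassum_real (bd (fun i => complex.Re (x i)) (fun i => normc_ge_Re _)).
have [|t ht] := hassum_real (bd (fun i => complex.Im (x i)) _).
  by move=> i; rewrite normc_def lecR -sqrtr_sqr ler_wsqrtr// lerDr sqr_ge0.
exists (s%:C + 'i * t%:C)%C.
have := hassumD (hassum_RtoC hs) (hassumZ 'i%C (hassum_RtoC ht)).
by under [X in hassum X _]eq_fun do rewrite -complexE.
Qed.

End Completeness.

Lemma abs_sumP (C : numClosedFieldType) (I : choiceType) (x : I -> C) s :
  abs_sum x s <-> absbounded x /\ hassum x s.
Proof.
have ps (y : I -> C) J : partial_sum y J = \sum_(i <- J) y i.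
  by rewrite /partial_sum big_seq_fsetE.
have tF := @totally_filter I.
split=> -[[M hM] h]; split.
- by exists M => J; rewrite -ps.
- move=> e e0; have /cvgrPdist_lt/(_ _ e0)[A _ hA] := h.
  by exists A => J /hA/=; rewrite ps distrC.
- by exists M => J; rewrite ps.
- apply/cvgrPdist_lt => e e0; have [A hA] := h _ e0.
  by exists A => // J /hA; rewrite ps distrC.
Qed.

(** * Uniqueness of power series coefficients *)

Lemma near_rowP (C : numFieldType) n (p : 'rV[C]_n) (P : 'rV[C]_n -> Prop) :
  (\forall z \near p, P z) <->
  exists2 r : C, 0 < r & forall z : 'rV[C]_n, (forall i, `|z 0 i - p 0 i| < r) -> P z.
Proof.
split=> [/nbhs_ballP[r /= r0 h]|[r r0 h]].
  exists r => // z hz; apply: h; split=> // i j.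
  by rewrite -ball_normE/= (ord1 i) distrC.
apply/nbhs_ballP; exists r => // z [_ hz]; apply: h => i.
by have := hz 0 i; rewrite -ball_normE/= distrC.
Qed.

Section PowerSeriesUnique.
Variables (C : numClosedFieldType) (n : nat).
Implicit Types (c : qseries C n) (z : 'rV[C]_n) (e : mexp n).

Definition eincr (i : 'I_n) (e : mexp n) : mexp n := [ffun j => (e j + (j == i))%N].
Definition edecr (i : 'I_n) (e : mexp n) : mexp n := [ffun j => (e j - (j == i))%N].
Definition set_coord (i : 'I_n) (t : C) (z : 'rV[C]_n) : 'rV[C]_n :=
  \row_j if j == i then t else z 0 j.

Lemma eincrK i : cancel (eincr i) (edecr i).
Proof. by move=> e; apply/ffunP => j; rewrite !ffunE addnK. Qed.

Lemma edecrK i e : e i != 0%N -> eincr i (edecr i e) = e.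
Proof.
move=> ei; apply/ffunP => j; rewrite !ffunE subnK//.
by have [->|//] := eqVneq j i; rewrite lt0n.
Qed.

Lemma set_coord_id i z : set_coord i (z 0 i) z = z.
Proof. by apply/rowP => j; rewrite mxE; case: eqP => // ->. Qed.

Lemma monom_set_coord i t z e :
  monom_at (set_coord i t z) e = t ^+ e i * \prod_(j < n | j != i) z 0 j ^+ e j.
Proof.
rewrite /monom_at (bigD1 i)//= mxE eqxx; congr (_ * _).
by apply: eq_bigr => j /negPf ji; rewrite mxE ji.
Qed.

Lemma monom_eincr i z e : monom_at z (eincr i e) = z 0 i * monom_at z e.
Proof.
rewrite /monom_at (bigD1 i)//= [in RHS](bigD1 i)//= ffunE eqxx addn1 exprS mulrA.
by congr (_ * _); apply: eq_bigr => j /negPf ji; rewrite ffunE ji addn0.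
Qed.

Lemma norm_monom_le z z' e :
  (forall i, `|z 0 i| <= `|z' 0 i|) -> `|monom_at z e| <= `|monom_at z' e|.
Proof.
move=> zz; rewrite !normr_prod; apply: ler_prod => i _.
by rewrite normr_ge0 !normrX lerXn2r ?nnegrE// zz.
Qed.

Lemma psum_at_unique c z u v : psum_at c z u -> psum_at c z v -> u = v.
Proof. by move=> /abs_sumP[_ hu] /abs_sumP[_ hv]; exact: hassum_unique hu hv. Qed.

Lemma psum_atB c d z u v : psum_at c z u -> psum_at d z v ->
  psum_at (fun e => c e - d e) z (u - v).
Proof.
move=> /abs_sumP[bu hu] /abs_sumP[bv hv]; apply/abs_sumP.
have E : (fun e => (c e - d e) * monom_at z e) =
    (fun e => c e * monom_at z e + - (d e * monom_at z e)).
  by apply/funext => e; rewrite mulrBl.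
by rewrite E; split; [exact: absboundedD bu (absboundedN bv)|exact: hassumD hu (hassumN hv)].
Qed.

Section Shift.
Variables (c : qseries C n) (r : C) (i : 'I_n).
Hypothesis c0 : forall z, (forall j, `|z 0 j| < r) -> psum_at c z 0.

(** Division by [z_i]: subtracting the series at the point with [i]-th coordinate 0 removes the
    monomials free of [z_i], and all the others contain a factor [z_i]. *)
Let psum_eincr_neq0 z : (forall j, `|z 0 j| < r) -> z 0 i != 0 ->
  psum_at (c \o eincr i) z 0.
Proof.
move=> zr zi; pose z0 := set_coord i 0 z.
have z0r j : `|z0 0 j| < r.
  by rewrite mxE; case: eqP => // _; rewrite normr0 (le_lt_trans _ (zr i)).
have /abs_sumP[bz hz] := c0 zr; have /abs_sumP[b0 h0] := c0 z0r.
pose x e := c e * monom_at z e - c e * monom_at z0 e.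
have xb : absbounded x by apply: absboundedD bz (absboundedN b0).
have xs : hassum x 0 by have := hassumD hz (hassumN h0); rewrite subr0.
have x0 e : eincr i (edecr i e) != e -> x e = 0.
  move=> he; have ei : e i = 0%N by apply/eqP/negPn/negP => /edecrK/eqP; rewrite (negPf he).
  by rewrite /x -{1}(set_coord_id i z) !monom_set_coord ei !expr0 subrr.
have xE : x \o eincr i = fun e => z 0 i * ((c \o eincr i) e * monom_at z e).
  apply/funext => e /=; rewrite /x !monom_eincr mxE eqxx mul0r mulr0 subr0.
  by rewrite mulrCA.
have := (hassum_reindex (@eincrK i) x0 0).1 xs.
have := (absbounded_reindex (@eincrK i) x0).1 xb.
rewrite !xE => /(absboundedZ (z 0 i)^-1) b1 /(hassumZ (z 0 i)^-1) h1.
apply/abs_sumP; move: b1 h1; rewrite mulr0.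
by under eq_fun do rewrite mulKf//.
Qed.

(* On the hyperplane [z_i = 0] the shifted series is compared with its values at
   small nonzero [z_i]. *)
Lemma psum_eincr z : (forall j, `|z 0 j| < r) -> psum_at (c \o eincr i) z 0.
Proof.
move=> zr; have [zi|/psum_eincr_neq0] := eqVneq (z 0 i) 0; last exact.
have r0 : 0 < r by rewrite (le_lt_trans _ (zr i)).
pose zt t := set_coord i t z; pose t0 := r / 2.
have t00 : 0 < t0 by rewrite divr_gt0.
have ztr t : 0 <= t <= t0 -> forall j, `|zt t 0 j| < r.
  move=> /andP[t_ge0 t_le] j; rewrite mxE; case: eqP => // _.
  by rewrite ger0_norm// (le_lt_trans t_le)// ltr_pdivrMr// ltr_pMr// ltr1n.
have H t : 0 < t <= t0 -> psum_at (c \o eincr i) (zt t) 0.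
  move=> /andP[t_gt0 t_le]; apply: psum_eincr_neq0.
    by apply: ztr; rewrite ltW.
  by rewrite mxE eqxx gt_eqF.
have /abs_sumP[[M hM] _] := H t0 ltac:(by rewrite t00 lexx).
have M0 : 0 <= M by have := hM fset0; rewrite big_seq_fset0.
have zE : z = zt 0 by rewrite -(set_coord_id i z) zi; apply/rowP => j; rewrite !mxE; case: eqP.
apply/abs_sumP; split.
  exists M => J; rewrite (le_trans _ (hM J))//; apply: ler_sum => e _.
  rewrite !normrM ler_wpM2l// norm_monom_le// => j; rewrite mxE.
  by case: eqP => // ->; rewrite zi normr0.
move=> eps eps0.
(* Monomials containing [z_i] shrink at least by the factor [t / t0] from [zt t0] to [zt t], and the
   others do not change. Replacing [zt t] by [z] thus costs at most [t / t0 * M], which this choice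
   keeps below [eps / 2]; the [+ 1] avoids dividing by zero. *)
pose t := Num.min t0 (eps / 2 * t0 / (M + 1)).
have M1 : 0 < M + 1 by rewrite ltr_wpDl.
have u0 : 0 < eps / 2 * t0 / (M + 1) by rewrite !divr_gt0// mulr_gt0// divr_gt0.
have cmp : (t0 >=< eps / 2 * t0 / (M + 1))%R by rewrite real_comparable// gtr0_real.
have t_gt0 : 0 < t by rewrite comparable_lt_min// t00 u0.
have t_le : t <= t0 by rewrite comparable_ge_min// lexx.
have tM : t / t0 * M <= eps / 2.
  have : t <= eps / 2 * t0 / (M + 1) by rewrite comparable_ge_min// lexx orbT.
  rewrite ler_pdivlMr// => tM; rewrite mulrAC ler_pdivrMr// (le_trans _ tM)//.
  by rewrite ler_wpM2l ?ltW// ltrDl.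
have /abs_sumP[_ ht] := H t ltac:(by rewrite t_gt0).
have eps2 : 0 < eps / 2 by rewrite divr_gt0.
have [A hA] := ht _ eps2.
exists A => J /hA; rewrite !subr0 => hJ.
rewrite [eps]splitr.
pose y e := c (eincr i e).
rewrite (_ : \sum_(e <- J) _ = \sum_(e <- J) y e * monom_at (zt t) e -
   \sum_(e <- J) y e * (monom_at (zt t) e - monom_at z e)); last first.
  by rewrite -sumrB; apply: eq_bigr => e _; rewrite -mulrBr subKr.
rewrite (le_lt_trans (ler_normB _ _))// ltr_leD// (le_trans _ tM)//.
rewrite (le_trans (ler_norm_sum _ _ _))//.
rewrite (@le_trans _ _ (t / t0 * \sum_(e <- J) `|y e * monom_at (zt t0) e|))//; last first.
  by apply: ler_wpM2l (hM J); rewrite divr_ge0 ?ltW.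
rewrite mulr_sumr; apply: ler_sum => e _.
rewrite !normrM mulrCA ler_wpM2l// zE !monom_set_coord -mulrBl !normrM mulrA ler_wpM2r//.
rewrite normrX (gtr0_norm t00) expr0n; case: (e i) => [|k].
  by rewrite expr0 subrr normr0 mulr_ge0 ?divr_ge0 ?ltW// exprn_ge0// ltW.
rewrite subr0 normrX (gtr0_norm t_gt0) !exprS mulrA divfK ?gt_eqF//.
by rewrite ler_pM2l// lerXn2r ?nnegrE// ltW.
Qed.
End Shift.

Lemma psum_at0 c : psum_at c 0 (c (mexp0 n)).
Proof.
pose A : {fset mexp n} := [fset mexp0 n]%fset.
have h0 e : e \notin A -> c e * monom_at 0 e = 0.
  rewrite inE => /eqP e0; suff /existsP[i ei] : [exists i, e i != 0%N].
    by rewrite /monom_at (bigD1 i)//= mxE expr0n (negPf ei) mul0r mulr0.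
  apply: contra_notT e0; rewrite negb_exists => /forallP h.
  by apply/ffunP => i; rewrite ffunE; apply/eqP; have := h i; rewrite negbK.
apply/abs_sumP; split; first exact: absbounded_fin h0.
have := hassum_fin h0; rewrite big_seq_fset1 /monom_at big1 ?mulr1// => i _.
by rewrite ffunE expr0.
Qed.

(** Induction on the total degree of [e]: the shift lowers one exponent and keeps the sum zero on
    the same polydisc, until only the constant coefficient remains, which is the value at 0. *)
Lemma psum_zero_coef c r : 0 < r ->
  (forall z, (forall i, `|z 0 i| < r) -> psum_at c z 0) -> forall e, c e = 0.
Proof.
move=> r0 + e; have [m] := ubnP (\sum_i e i); elim: m => // m IH in c e *.
rewrite ltnS => em cr.
have [/existsP[i ei]|] := boolP [exists i, e i != 0%N].
  rewrite -(edecrK ei); apply: (IH (c \o eincr i)); last exact: psum_eincr cr.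
  rewrite (leq_trans _ em)// (bigD1 i)//= [leqRHS](bigD1 i)//= ffunE eqxx.
  rewrite -[X in (X <= _)%N]addSn leq_add ?subn1 ?prednK ?lt0n//.
  by apply: leq_sum => j _; rewrite ffunE leq_subr.
rewrite negb_exists => /forallP h.
have -> : e = mexp0 n by apply/ffunP => i; rewrite ffunE; apply/eqP; have := h i; rewrite negbK.
apply: (psum_at_unique (psum_at0 c)); apply: cr => i.
by rewrite mxE normr0.
Qed.

Lemma entire_series_unique c d F :
  entire_series c F -> entire_series d F -> c = d.
Proof.
move=> hc hd; apply/funext => e; apply/eqP; rewrite -subr_eq0; apply/eqP.
apply: (@psum_zero_coef (fun e => c e - d e) 1) => // z _.
by have := psum_atB (hc z) (hd z); rewrite subrr.
Qed.

End PowerSeriesUnique.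

(** * Analytic continuation of entire series *)

Section AnalyticContinuation.
Variables (C : numClosedFieldType) (n : nat).
Hypothesis sum_complete : forall (I : choiceType) (x : I -> C),
  absbounded x -> exists s, hassum x s.
Implicit Types (c : qseries C n) (z w p : 'rV[C]_n) (e d : mexp n).

Let binom_monom (x y : 'I_n -> C) e d : C :=
  \prod_i ('C(e i, d i)%:R * x i ^+ (e i - d i) * y i ^+ d i).

Let sum_binom (x y : C) (m B : nat) : (m < B)%N ->
  \sum_(k < B) 'C(m, k)%:R * x ^+ (m - k) * y ^+ k = (x + y) ^+ m.
Proof.
move=> mB; rewrite exprDn (big_ord_widen _ (fun k => x ^+ (m - k) * y ^+ k *+ 'C(m, k)) mB).
rewrite [RHS]big_mkcond/=; apply: eq_bigr => k _; rewrite ltnS; case: leqP => km.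
  by rewrite -[RHS]mulr_natl mulrA.
by rewrite bin_small// !mul0r.
Qed.

Let hassum_binom (x y : 'I_n -> C) e :
  hassum (binom_monom x y e) (\prod_i (x i + y i) ^+ e i).
Proof.
pose B := (\max_i e i).+1.
rewrite (eq_bigr (fun i : 'I_n => \sum_(k < B) 'C(e i, k)%:R * x i ^+ (e i - k) * y i ^+ k)).
  apply: (hassum_box (y := fun i k => 'C(e i, k)%:R * x i ^+ (e i - k) * y i ^+ k)).
  move=> i k Bk; rewrite bin_small ?mul0r//; apply: leq_trans Bk.
  by rewrite ltnS (leq_bigmax i).
by move=> i _; rewrite sum_binom// ltnS (leq_bigmax i).
Qed.

Let sum_binom_le (x y : 'I_n -> C) e (J : {fset mexp n}) :
  \sum_(d <- J) `|binom_monom x y e d| <= \prod_i (`|x i| + `|y i|) ^+ e i.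
Proof.
rewrite (eq_bigr _ (fun d _ => normr_prod _ _ _)).
apply: (sum_prod_le
  (y := fun i k => `|'C(e i, k)%:R * x i ^+ (e i - k) * y i ^+ k|)) => // i B.
rewrite -(@sum_binom _ _ _ (e i + B).+1) ?ltnS ?leq_addr//.
rewrite (eq_bigr (fun k : 'I_B => 'C(e i, k)%:R * `|x i| ^+ (e i - k) * `|y i| ^+ k)).
  rewrite -addSn addnC big_split_ord/= lerDl; apply: sumr_ge0 => k _.
  by rewrite !mulr_ge0// exprn_ge0.
by move=> k _; rewrite !normrM !normrX normr_nat.
Qed.

(* Expand each monomial of [G (p + w)] by the binomial theorem and exchange the
   order of summation. *)
Lemma recenter c (G : 'rV[C]_n -> C) (rho delta : C) p :
  0 < delta -> (forall i, `|p 0 i| <= rho) ->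
  (forall z, (forall i, `|z 0 i| < rho + delta) -> psum_at c z (G z)) ->
  exists c', forall w, (forall i, `|w 0 i| < delta) -> psum_at c' w (G (p + w)).
Proof.
move=> d0 prho hG.
pose X w (ed : mexp n * mexp n) :=
  c ed.1 * binom_monom (fun i => p 0 i) (fun i => w 0 i) ed.1 ed.2.
have Xb w : (forall i, `|w 0 i| < delta) -> absbounded (X w).
  (* With [p] and [w] replaced by their absolute values, the double sum is dominated by the series
     at the point [a], which still lies in the polydisc of convergence. *)
  move=> wd; pose a : 'rV[C]_n := \row_i (`|p 0 i| + `|w 0 i|).
  have /abs_sumP[ab _] : psum_at c a (G a).
    by apply: hG => i; rewrite mxE ger0_norm ?addr_ge0// ler_ltD.
  apply: absbounded_prod ab _ => e J.
  under eq_bigr do rewrite /X normrM/=.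
  rewrite -mulr_sumr normrM ler_wpM2l// (le_trans (sum_binom_le _ _ _ _))//.
  have -> : monom_at a e = \prod_i (`|p 0 i| + `|w 0 i|) ^+ e i.
    by apply: eq_bigr => i _; rewrite mxE.
  by rewrite ger0_norm// prodr_ge0// => i _; rewrite exprn_ge0 ?addr_ge0.
(* The new coefficients must not depend on [w]. Their defining sums converge absolutely because
   those at the fixed point [w1] do, and the coordinates of [w1] are nonzero, so its monomials can
   be divided out. *)
pose w1 : 'rV[C]_n := \row_i (delta / 2).
have dd : 0 < delta / 2 by rewrite divr_gt0.
have w1d i : `|w1 0 i| < delta.
  by rewrite mxE gtr0_norm// ltr_pdivrMr// ltr_pMr// ltr1n.
pose Y (de : mexp n * mexp n) :=
  c de.2 * \prod_i ('C(de.2 i, de.1 i)%:R * p 0 i ^+ (de.2 i - de.1 i)).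
have XY w d e : X w (e, d) = monom_at w d * Y (d, e).
  by rewrite /X /Y /binom_monom /monom_at/= [in LHS]big_split/=; ring.
have Yb d : absbounded (fun e => Y (d, e)).
  have := absboundedZ (monom_at w1 d)^-1
    (@absbounded_inj _ _ _ (fun e => (e, d)) _ _ (Xb _ w1d)).
  move=> /(_ ltac:(by move=> ? ? [])); congr absbounded; apply/funext => e /=.
  rewrite XY mulKf//; apply/prodf_neq0 => i _.
  by rewrite mxE expf_neq0// gt_eqF.
pose c' d := projT1 (cid (sum_complete (Yb d))).
have c'P d : hassum (fun e => Y (d, e)) (c' d) := projT2 (cid (sum_complete (Yb d))).
exists c' => w wd.
have [s hs] := sum_complete (Xb w wd).
have rows e : hassum (fun d => X w (e, d)) (c e * monom_at (p + w) e).
  have := hassumZ (c e) (hassum_binom (fun i => p 0 i) (fun i => w 0 i) e).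
  by rewrite /monom_at; under [in X in _ -> X]eq_bigr do rewrite mxE.
have cols d : hassum (fun e => X w (e, d)) (c' d * monom_at w d).
  by rewrite mulrC; under eq_fun do rewrite XY; exact: hassumZ.
have swK : cancel (fun q : mexp n * mexp n => (q.2, q.1)) (fun q => (q.2, q.1)).
  by case.
have sw0 k : ((k.2, k.1).2, (k.2, k.1).1) != k -> X w k = 0 by case: k => e d /eqP.
have hs' := (hassum_reindex swK sw0 s).1 hs.
have bs' := (absbounded_reindex swK sw0).1 (Xb w wd).
apply/abs_sumP; split; first exact: absbounded_fubini bs' cols.
suff <- : s = G (p + w) by exact: hassum_fubini hs' cols.
apply: hassum_unique (hassum_fubini hs rows) _.
suff /abs_sumP[] : psum_at c (p + w) (G (p + w)) by [].
by apply: hG => i; rewrite mxE (le_lt_trans (ler_normD _ _))// ler_ltD.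
Qed.

(* Since [p] is close to the origin, the disc of convergence around [p] contains it. *)
Lemma psum_zero_propagates c (h : 'rV[C]_n -> C) (r eta : C) p :
  0 < r -> 0 < eta ->
  (forall w, (forall i, `|w 0 i| < r) -> psum_at c w (h w)) ->
  (forall i, `|p 0 i| <= r / 4) ->
  (forall w, (forall i, `|w 0 i - p 0 i| < eta) -> h w = 0) ->
  forall w, (forall i, `|w 0 i| < r / 4) -> h w = 0.
Proof.
move=> r0 eta0 hc pr hp w wr; pose delta := r / 4 *+ 3.
have r4 : 0 < r / 4 by rewrite divr_gt0.
have d0 : 0 < delta by rewrite pmulrn_lgt0.
have rE : r / 4 + delta = r by rewrite /delta; field.
have hc1 z : (forall i, `|z 0 i| < r / 4 + delta) -> psum_at c z (h z).
  by rewrite rE; exact: hc.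
have [c' hc'] := recenter d0 pr hc1.
pose et := Num.min eta delta.
have cmp : (eta >=< delta)%R by rewrite real_comparable// gtr0_real.
have et0 : 0 < et by rewrite comparable_lt_min// eta0.
have c'0 : forall e, c' e = 0.
  apply: (psum_zero_coef et0) => z zr.
  rewrite -(hp (p + z)); last first.
    move=> i; rewrite mxE addrAC subrr add0r; apply: lt_le_trans (zr i) _.
    by rewrite comparable_ge_min// lexx.
  apply: hc' => i; apply: lt_le_trans (zr i) _.
  by rewrite comparable_ge_min// lexx orbT.
have := hc' (w - p); rewrite (addrC p) subrK => h1.
have /abs_sumP[_] : psum_at c' (w - p) (h w).
  apply: h1 => i; rewrite !mxE (le_lt_trans (ler_normB _ _))//.
  rewrite (lt_le_trans (ltr_leD (wr i) (pr i)))// -mulr2n /delta.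
  by rewrite ler_pMn2l.
under eq_fun do rewrite c'0 mul0r.
by move=> h2; exact: hassum_unique h2 (@hassum0 C _).
Qed.

Hypothesis row_connected : connected [set: 'rV[C]_n].

(** Existence takes the whole space as domain. For uniqueness, the interior of the set where [g] and
    [G] agree is nonempty, open and relatively closed in the connected domain [U]. *)
Lemma extended_value_entire c (G : 'rV[C]_n -> C) w :
  entire_series c G -> extended_value c w (G w).
Proof.
move=> hG; split.
  exists setT, G; split=> //; split=> //; first exact: openT.
    move=> p _; pose rho : C := \sum_i `|p 0 i|.
    have prho i : `|p 0 i| <= rho by rewrite /rho (bigD1 i)//= lerDl sumr_ge0.
    have [c' hc'] := recenter ltr01 prho (fun z _ => hG z).
    exists c'; apply/near_rowP; exists 1 => // z hz.
    have := hc' (z - p); rewrite (addrC p) subrK; apply => i.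
    by rewrite !mxE.
  by apply/near_rowP; exists 1.
move=> v [U [g [[oU cU U0 ag g0] Uw <-]]].
pose E : set 'rV[C]_n := [set z | g z = G z].
have VU : U `&` E° = U.
  apply: cU.
  - exists 0; split=> //; apply: filterS g0 => z hz.
    exact: psum_at_unique hz (hG z).
  - by exists E° => //; exact: open_interior.
  exists (closure E°); first exact: closed_closure.
  apply/seteqP; split=> p [Up Ep]; split=> //; first exact: subset_closure.
  have [c1 /near_rowP[r r0 hc1]] := ag p Up.
  pose rho : C := \sum_i `|p 0 i|.
  have prho i : `|p 0 i| <= rho by rewrite /rho (bigD1 i)//= lerDl sumr_ge0.
  have [c2 hc2] := recenter r0 prho (fun z _ => hG z).
  pose h (u : 'rV[C]_n) : C := g (p + u) - G (p + u).
  have hh (u : 'rV[C]_n) : (forall i, `|u 0 i| < r) -> psum_at (fun e => c1 e - c2 e) u (h u).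
    move=> ur; apply: psum_atB (hc2 u ur).
    have puK : p + u - p = u by rewrite addrAC subrr add0r.
    have := hc1 (p + u); rewrite puK; apply => i.
    by rewrite mxE addrAC subrr add0r.
  have r4 : 0 < r / 4 by rewrite divr_gt0.
  have : nbhs p [set z | forall i, `|z 0 i - p 0 i| < r / 4].
    by apply/near_rowP; exists (r / 4).
  (* A limit point [p] of the interior has a point [p'] of it within [r / 4]. Both functions are
     expanded at [p]; their difference vanishes near [p'], hence on the whole polydisc of radius
     [r / 4] around [p]. *)
  move=> /Ep[p' [/near_rowP[eta eta0 hp'] p'r]].
  have h0 : forall u : 'rV[C]_n, (forall i, `|u 0 i| < r / 4) -> h u = 0.
    apply: (@psum_zero_propagates (fun e => c1 e - c2 e) h r eta (p' - p)) => //.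
      by move=> i; rewrite !mxE ltW.
    move=> u hu; apply/eqP; rewrite subr_eq0; apply/eqP; apply: hp' => i.
    by have := hu i; rewrite !mxE opprB addrA [p 0 i + _]addrC.
  apply/near_rowP; exists (r / 4) => // z hz.
  have := h0 (z - p); rewrite /h (addrC p) subrK => /(_ _)/eqP.
  rewrite subr_eq0 => hz'; apply/eqP/hz' => i.
  by rewrite !mxE.
have : (U `&` E°) w by rewrite VU.
by move=> [_ /nbhs_singleton ->].
Qed.
End AnalyticContinuation.

(** The space is a union of segments issuing from the origin, each a continuous image of the real
    interval [[0, 1]]. *)
Lemma connected_row_setT (R : realType) n :
  let C : numClosedFieldType := R[i] in connected [set: 'rV[C]_n].
Proof.
move=> C.
have -> : [set: 'rV[C]_n] = \bigcup_(z in setT) [set (t%:C%C : C) *: z | t in `[0, 1 : R]].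
  apply/seteqP; split=> // z _; exists z => //; exists 1; rewrite ?scale1r//=.
  by rewrite in_itv/= ler01 lexx.
apply: bigcup_connected => [|z _].
  by exists 0 => z _; exists 0; rewrite ?scale0r//= in_itv/= ler01 lexx.
apply: connected_continuous_connected; first exact: segment_connected.
apply: continuous_subspaceT => t A /near_rowP[r r0 hA].
pose M : C := 1 + \sum_i `|z 0 i|.
have M0 : 0 < M by rewrite ltr_pwDl// sumr_ge0.
have d0 : 0 < r / M by rewrite divr_gt0.
have dE : r / M = (complex.Re (r / M))%:C%C by rewrite RRe_real// gtr0_real.
have d0' : 0 < complex.Re (r / M) by move: d0; rewrite dE ltcR.
apply/nbhs_ballP; exists (complex.Re (r / M)) => // s hs; apply: hA => i.
rewrite !mxE -mulrBl -rmorphB/= normrM.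
have ns : `|(s - t)%:C%C : C| < r / M.
  by rewrite normc_def/= expr0n addr0 sqrtr_sqr dE ltcR distrC; move: hs; rewrite -ball_normE.
have zM : `|z 0 i| < M.
  by rewrite /M (bigD1 i)//= addrCA ltrDl ltr_pwDl// sumr_ge0.
rewrite (@le_lt_trans _ _ (`|(s - t)%:C%C : C| * M))//; first by rewrite ler_wpM2l// ltW.
by rewrite -ltr_pdivlMr.
Qed.

(** * Uniqueness of the iterated lattice integral *)

Section LatticeUnique.
Variables (C : numClosedFieldType) (n : nat) (q : C) (sigma : 'S_n) (gam : 'I_n -> C).

Lemma abs_sum_unique (I : choiceType) (x : I -> C) s t :
  abs_sum x s -> abs_sum x t -> s = t.
Proof. by move=> /abs_sumP[_ hs] /abs_sumP[_ ht]; exact: hassum_unique hs ht. Qed.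

Lemma is_lattice_integral_unique l (c : qseries C n) F G :
  is_lattice_integral q gam l c F -> is_lattice_integral q gam l c G -> F = G.
Proof.
move=> hF hG; apply/funext => z; have [f hf sf] := hF z; have [g hg sg] := hG z.
have fg : f = g by apply/funext => p; exact: ((hf p).2 _ (hg p).1).
by rewrite fg in sf; exact: abs_sum_unique sf sg.
Qed.

(** Each step is determined in two stages: the integral fixes the function [F], because extended
    values are unique by definition, and an entire function fixes its coefficients. *)
Lemma lattice_value_unique f u v :
  lattice_value q sigma gam f u -> lattice_value q sigma gam f v -> u = v.
Proof.
move=> [phi [phi0 [_ hphi] <-]] [psi [psi0 [_ hpsi] <-]].
suff E k : (k <= n)%N -> phi k = psi k by rewrite E.
elim: k => [_|k IH kn]; first by rewrite phi0 psi0.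
have [_ [F hF eF]] := hphi (Ordinal kn); have [_ [G hG eG]] := hpsi (Ordinal kn).
move: hG; rewrite /= -IH ?(ltnW kn)// => hG.
rewrite (is_lattice_integral_unique hG hF) in eG.
exact: entire_series_unique eF eG.
Qed.

Lemma lattice_intE f v : lattice_value q sigma gam f v -> lattice_int q sigma gam f = v.
Proof.
move=> hv; apply: (@lattice_value_unique f _ _ _ hv).
exact: (xgetPex 0 (ex_intro _ v hv)).
Qed.
End LatticeUnique.

(** * The Euler series and infinite products *)

Section QSeries.
Variable C : numClosedFieldType.
Hypothesis sum_complete : forall (I : choiceType) (x : I -> C),
  absbounded x -> exists s, hassum x s.

Definition tsum (I : choiceType) (x : I -> C) : C := xget 0 [set s | hassum x s].

Lemma tsumP (I : choiceType) (x : I -> C) : absbounded x -> hassum x (tsum x).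
Proof. by move=> /sum_complete h; exact: (xgetPex 0 h). Qed.

Lemma hassum_succ (x : nat -> C) s : x 0%N = 0 -> hassum x s <-> hassum (x \o succn) s.
Proof.
by move=> x0; apply: (@hassum_reindex C nat nat succn predn) => // -[|k]; rewrite /= ?x0 ?eqxx.
Qed.

Lemma hassum_tail (x : nat -> C) s e : hassum x s -> 0 < e ->
  exists N, forall k, (N <= k)%N -> `|x k| < e.
Proof.
move=> hs e0; have e2 : 0 < e / 2 by rewrite divr_gt0.
have [A hA] := hs _ e2; exists (\max_(k <- A) k).+1 => k kN.
have kA : k \notin A.
  by apply/negP => kA; move: kN; rewrite (big_rem k)//= ltnNge leq_maxl.
have := hA _ (fsubsetUr [fset k]%fset A); have := hA _ (fsubset_refl A).
rewrite big_fsetU1//=; set S := \sum_(_ <- _) _ => h1 h2.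
rewrite (_ : x k = (x k + S - s) - (S - s)); last by ring.
by rewrite (le_lt_trans (ler_normB _ _))// [ltRHS]splitr ltrD.
Qed.

(** Without an archimedean axiom, the decay of [r^k] is drawn from completeness: the geometric
    series is summable, and the terms of a summable sequence tend to 0. *)
Lemma expr_tail (r e : C) : 0 <= r < 1 -> 0 < e ->
  exists N, forall k, (N <= k)%N -> r ^+ k < e.
Proof.
move=> r01 e0; have /sum_complete[s hs] : absbounded (fun k => r ^+ k).
  apply: (ratio_test (N := 0) r01) => k _.
  by case/andP: r01 => r0 _; rewrite exprS normrM ger0_norm.
have [N hN] := hassum_tail hs e0; exists N => k /hN.
by case/andP: r01 => r0 _; rewrite ger0_norm// exprn_ge0.
Qed.

(** A Lipschitz bound at the origin; applied at [y = x p^k] it makes the tail factors of the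
    infinite products tend to 1. *)
Lemma series_near0 (a : nat -> C) (rho : C) : 0 < rho ->
  absbounded (fun k => a k * rho ^+ k) ->
  exists2 M : C, 0 <= M & forall y s : C, `|y| <= rho ->
    hassum (fun k => a k * y ^+ k) s -> `|s - a 0%N| <= M * `|y|.
Proof.
move=> rho0 [M hM]; exists (M / rho).
  by rewrite divr_ge0 ?(ltW rho0)//; have := hM fset0; rewrite big_seq_fset0.
move=> y s yr hs.
have h0 : hassum (fun k : nat => if k == 0%N then a 0%N else 0) (a 0%N).
  have := @hassum_fin C nat (fun k => if k == 0%N then a 0%N else 0) [fset 0%N]%fset.
  by rewrite big_seq_fset1; apply=> k; rewrite inE => /negPf ->.
apply: (hassum_norm_le _ (hassumD hs (hassumN h0))) => J.
have -> : M / rho * `|y| = `|y| / rho * M by ring.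
apply: (@le_trans _ _ (`|y| / rho * \sum_(k <- J) `|a k * rho ^+ k|)); last first.
  by apply: ler_wpM2l (hM J); rewrite divr_ge0// ltW.
rewrite mulr_sumr; apply: ler_sum => -[|k] _ /=.
  by rewrite expr0 mulr1 subrr normr0 mulr_ge0// divr_ge0// ltW.
rewrite subr0 !normrM mulrCA ler_wpM2l// !normrX !exprS (ger0_norm (ltW rho0)).
rewrite mulrA divfK ?gt_eqF// ler_wpM2l//.
by rewrite lerXn2r ?nnegrE// ltW.
Qed.

Lemma qpoch0 (a p : C) : qpoch a p 0 = 1.
Proof. by rewrite /qpoch big_ord0. Qed.

Lemma qpochS (a p : C) k : qpoch a p k.+1 = qpoch a p k * (1 - a * p ^+ k).
Proof. by rewrite /qpoch big_ord_recr. Qed.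

Lemma cvg_seq_unique (u : nat -> C) (a b : C) : u @ \oo --> a -> u @ \oo --> b -> a = b.
Proof. by move=> ha hb; apply: (cvg_unique _ ha hb); exact: norm_hausdorff. Qed.

Section Base.
Variable p : C.
Hypotheses (p_gt0 : 0 < p) (p_lt1 : p < 1).

Let p01 : 0 <= p < 1. Proof. by rewrite p_lt1 ltW. Qed.

Lemma qfactor_gt0 k : 0 < 1 - p ^+ k.+1.
Proof. by rewrite subr_gt0 exprn_ilt1// ltW. Qed.

Lemma qpochpp_gt0 k : 0 < qpoch p p k.
Proof. by apply: prodr_gt0 => l _; rewrite -exprS qfactor_gt0. Qed.

Lemma e_coefS k : e_coef p k.+1 * (1 - p ^+ k.+1) = e_coef p k.
Proof.
by rewrite /e_coef qpochS -exprS invfM -mulrA mulVf ?mulr1// gt_eqF// qfactor_gt0.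
Qed.

Lemma e_coef0 : e_coef p 0 = 1.
Proof. by rewrite /e_coef qpoch0 invr1. Qed.

Lemma E_coefS k : E_coef p k.+1 * (1 - p ^+ k.+1) = E_coef p k * p ^+ k.
Proof.
rewrite /E_coef qpochS -exprS binS bin1 exprD; field.
by rewrite !gt_eqF// ?qfactor_gt0// qpochpp_gt0.
Qed.

Lemma E_coef0 : E_coef p 0 = 1.
Proof. by rewrite /E_coef qpoch0 divr1 expr0. Qed.

Lemma absbounded_E (x : C) : absbounded (fun k => E_coef p k * x ^+ k).
Proof.
have q1 : 0 < 1 - p by rewrite subr_gt0.
(* Consecutive terms have ratio [p^k x / (1 - p^(k+1))], at most 1/2 in absolute value once [p^k] is
   below this bound. *)
have e0 : 0 < (1 - p) / (2 * (`|x| + 1)) by rewrite divr_gt0// mulr_gt0// ltr_wpDl.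
have [N hN] := expr_tail p01 e0.
apply: (@ratio_test _ _ 2^-1 N) => [|k Nk].
  by rewrite invr_ge0 ler0n/= invf_lt1// ltr1n.
rewrite -(ler_pM2r (qfactor_gt0 k)) -[X in _ * X <= _](gtr0_norm (qfactor_gt0 k)) -normrM.
rewrite mulrAC E_coefS; move: (E_coef p k) => c.
have -> : c * p ^+ k * x ^+ k.+1 = c * x ^+ k * (p ^+ k * x) by rewrite exprS; ring.
rewrite normrM [leRHS]mulrAC [leRHS]mulrC ler_wpM2l// normrM normrX (gtr0_norm p_gt0).
have x1 : 0 < `|x| + 1 by rewrite ltr_wpDl.
apply: (@le_trans _ _ ((1 - p) / (2 * (`|x| + 1)) * (`|x| + 1))).
  by rewrite ler_pM// ?exprn_ge0 ?(ltW p_gt0)// ?lerDl// ltW// hN.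
rewrite invfM mulrA divfK ?gt_eqF// mulrC ler_wpM2l// ?invr_ge0//.
by rewrite lerD2l lerN2 exprS ler_piMr ?(ltW p_gt0)// exprn_ile1// ltW.
Qed.

Lemma absbounded_e (t : C) : `|t| < 1 -> absbounded (fun k => e_coef p k * t ^+ k).
Proof.
move=> t1; pose r := (1 + `|t|) / 2.
have t1' : 0 < 1 - `|t| by rewrite subr_gt0.
have r0 : 0 < r by rewrite divr_gt0// ltr_pwDl.
have r1 : r < 1 by rewrite ltr_pdivrMr// mul1r -[ltRHS]/(1 + 1) ltrD2l.
(* The ratio [t / (1 - p^(k+1))] is bounded by the midpoint [r] of [|t|] and 1 as soon as
   [r p^(k+1)] is at most [r - |t| = (1 - |t|) / 2]. *)
have [N hN] := expr_tail p01 (divr_gt0 t1' (ltr0n C 2)).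
apply: (@ratio_test _ _ r N) => [|k Nk]; first by rewrite (ltW r0).
rewrite -(ler_pM2r (qfactor_gt0 k)) -[X in _ * X <= _](gtr0_norm (qfactor_gt0 k)) -normrM.
rewrite mulrAC e_coefS exprS mulrCA normrM mulrAC ler_wpM2r//.
have := hN k.+1 (leqW Nk); rewrite ltr_pdivlMr// => h.
rewrite mulrBr mulr1 lerBrDr.
have : r * p ^+ k.+1 <= p ^+ k.+1 by rewrite ler_piMl ?exprn_ge0 ?ltW.
move=> h1; rewrite -(ler_pM2r (ltr0n C 2)) mulrDl /r divfK ?pnatr_eq0//.
have h2 : r * p ^+ k.+1 * 2 <= 1 - `|t|.
  by rewrite (le_trans _ (ltW h))// ler_wpM2r.
rewrite -lerBrDl (le_trans h2)// mulr2n mulrDr mulr1.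
by rewrite opprD addrA addrAC [1 + _]addrC addrK.
Qed.

(** Euler's series for [(x; p)_inf], and below it the one for [1 / (t; p)_inf]. They are identified
    with these products in [qpoch_infE] and [Etheta_epsi], by way of their functional equations. *)
Definition Etheta (x : C) : C := tsum (fun k => E_coef p k * (- x) ^+ k).
Definition epsi (t : C) : C := tsum (fun k => e_coef p k * t ^+ k).

Lemma EthetaP x : hassum (fun k => E_coef p k * (- x) ^+ k) (Etheta x).
Proof. exact/tsumP/absbounded_E. Qed.

Lemma epsiP (t : C) : `|t| < 1 -> hassum (fun k => e_coef p k * t ^+ k) (epsi t).
Proof. by move=> t1; exact/tsumP/absbounded_e. Qed.

Lemma Etheta_rec x : Etheta x = (1 - x) * Etheta (p * x).
Proof.
suff : Etheta x - Etheta (p * x) = - x * Etheta (p * x).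
  by move=> /eqP; rewrite subr_eq => /eqP ->; ring.
pose y k := E_coef p k * (- x) ^+ k - E_coef p k * (- (p * x)) ^+ k.
have hy : hassum y (Etheta x - Etheta (p * x)).
  exact: hassumD (EthetaP x) (hassumN (EthetaP (p * x))).
have y0 : y 0%N = 0 by rewrite /y !expr0 subrr.
have := (hassum_succ _ y0).1 hy => hy1.
apply: hassum_unique hy1 _.
have := hassumZ (- x) (EthetaP (p * x)); congr (hassum _ _); apply/funext => k /=.
rewrite /y -mulrN !exprMn.
transitivity (E_coef p k.+1 * (1 - p ^+ k.+1) * (- x) ^+ k.+1); last by ring.
by rewrite E_coefS [(- x) ^+ k.+1]exprS; ring.
Qed.

Lemma epsi_rec (t : C) : `|t| < 1 -> epsi (p * t) = (1 - t) * epsi t.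
Proof.
move=> t1; have pt1 : `|p * t| < 1.
  by rewrite normrM (gtr0_norm p_gt0) (le_lt_trans _ t1)// ler_piMl// ltW.
suff : epsi t - epsi (p * t) = t * epsi t.
  by move=> /eqP; rewrite subr_eq addrC -subr_eq => /eqP <-; ring.
pose y k := e_coef p k * t ^+ k - e_coef p k * (p * t) ^+ k.
have hy : hassum y (epsi t - epsi (p * t)).
  exact: hassumD (epsiP t1) (hassumN (epsiP pt1)).
have y0 : y 0%N = 0 by rewrite /y !expr0 subrr.
have := (hassum_succ _ y0).1 hy => hy1.
apply: hassum_unique hy1 _.
have := hassumZ t (epsiP t1); congr (hassum _ _); apply/funext => k /=.
by rewrite /y !exprMn -(e_coefS k) !exprS; ring.
Qed.

Lemma Etheta_qpoch x k : Etheta x = qpoch x p k * Etheta (x * p ^+ k).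
Proof.
elim: k => [|k IH]; first by rewrite qpoch0 expr0 mulr1 mul1r.
by rewrite IH Etheta_rec qpochS exprS -[RHS]mulrA [x * (p * _)]mulrCA.
Qed.

Lemma epsi_qpoch (t : C) k : `|t| < 1 -> epsi (t * p ^+ k) = qpoch t p k * epsi t.
Proof.
move=> t1; elim: k => [|k IH]; first by rewrite qpoch0 expr0 mulr1 mul1r.
have tk : `|t * p ^+ k| < 1.
  rewrite normrM (le_lt_trans _ t1)// ler_piMr//.
  by rewrite ger0_norm ?exprn_ge0 ?exprn_ile1 ?ltW.
by rewrite exprS mulrCA epsi_rec// IH qpochS mulrCA mulrA.
Qed.

Let cvg_pow_error (u : nat -> C) M : 0 <= M ->
  (forall k, `|u k - 1| <= M * p ^+ k) -> u @ \oo --> (1 : C).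
Proof.
move=> M0 hu; apply/cvgrPdist_lt => e e0.
have M1 : 0 < M + 1 by rewrite ltr_wpDl.
have [N hN] := expr_tail p01 (divr_gt0 e0 M1).
exists N => // k /= Nk; rewrite distrC (le_lt_trans (hu k))//.
have := hN _ Nk; rewrite ltr_pdivlMr// mulrC; apply: le_lt_trans.
by rewrite ler_wpM2r ?exprn_ge0 ?lerDl// ltW.
Qed.

(** [Etheta x] is the finite product times [Etheta (x p^k)], and the latter factor tends to
    [E_coef p 0 = 1]; it is eventually nonzero, so it can be divided out. *)
Lemma cvg_qpoch x : qpoch x p k @[k --> \oo] --> Etheta x.
Proof.
have b1 : absbounded (fun k => (E_coef p k * (-1) ^+ k) * (`|x| + 1) ^+ k).
  have := absbounded_E (- (`|x| + 1)); congr (absbounded _); apply/funext => k.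
  by rewrite -mulrA -exprMn mulN1r.
have x1 : 0 < `|x| + 1 by rewrite ltr_wpDl.
have [M M0 hM] := series_near0 x1 b1.
have cu : (fun k => Etheta (x * p ^+ k)) @ \oo --> (1 : C).
  apply: (@cvg_pow_error _ (M * `|x|)); first by rewrite mulr_ge0.
  move=> k; have := hM (x * p ^+ k) (Etheta (x * p ^+ k)).
  rewrite E_coef0 expr0 mulr1 normrM (ger0_norm (exprn_ge0 k (ltW p_gt0))) mulrA; apply.
    rewrite (@le_trans _ _ `|x|) ?lerDl// ler_piMr// exprn_ile1// ltW//.
  have := EthetaP (x * p ^+ k); congr (hassum _ _); apply/funext => j.
  by rewrite -mulrA -exprMn mulN1r.
have : (fun k => Etheta x * (Etheta (x * p ^+ k))^-1) @ \oo --> Etheta x * 1^-1.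
  apply: cvgM; first exact: cvg_cst.
  by apply: cvgV => //; rewrite oner_eq0.
rewrite invr1 mulr1; apply: cvg_trans; apply: near_eq_cvg.
have /cvgrPdist_lt/(_ 1 ltr01) := cu; apply: filterS => k hk.
rewrite (Etheta_qpoch x k) mulfK//; apply/eqP => h0.
by move: hk; rewrite h0 subr0 normr1 ltxx.
Qed.

Lemma qpoch_infE x : qpoch_inf x p = Etheta x.
Proof. by apply/cvg_lim; [exact: norm_hausdorff|exact: cvg_qpoch]. Qed.

(** No multiplication of series is involved: [epsi (t p^k) = (t; p)_k epsi t] tends to 1 by
    continuity at 0 and to [Etheta t * epsi t] by convergence of the product. *)
Lemma Etheta_epsi (t : C) : `|t| < 1 -> Etheta t * epsi t = 1.
Proof.
move=> t1; pose rho := (1 + `|t|) / 2.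
have r0 : 0 < rho by rewrite divr_gt0// ltr_pwDl.
have r1 : `|rho| < 1.
  by rewrite gtr0_norm// ltr_pdivrMr// mul1r -[ltRHS]/(1 + 1) ltrD2l.
have tr : `|t| <= rho.
  by rewrite ler_pdivlMr// mulr2n mulrDr mulr1 lerD2r ltW.
have [M M0 hM] := series_near0 r0 (absbounded_e r1).
have cu : (fun k => epsi (t * p ^+ k)) @ \oo --> (1 : C).
  apply: (@cvg_pow_error _ (M * `|t|)); first by rewrite mulr_ge0.
  move=> k; have tk : `|t * p ^+ k| <= `|t|.
    rewrite normrM ler_piMr//.
    by rewrite ger0_norm ?exprn_ge0 ?exprn_ile1 ?ltW.
  have := hM (t * p ^+ k) (epsi (t * p ^+ k)).
  rewrite e_coef0 normrM (ger0_norm (exprn_ge0 k (ltW p_gt0))) mulrA; apply.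
    by move: tk; rewrite normrM (ger0_norm (exprn_ge0 k (ltW p_gt0))) => /le_trans; apply.
  by apply: epsiP; exact: le_lt_trans t1.
have cv : (fun k => epsi (t * p ^+ k)) @ \oo --> Etheta t * epsi t.
  rewrite (_ : (fun k => _) = (fun k => qpoch t p k * epsi t)); last first.
    by apply/funext => k; rewrite epsi_qpoch.
  by apply: cvgM; [exact: cvg_qpoch|exact: cvg_cst].
exact: cvg_seq_unique cv cu.
Qed.

End Base.
End QSeries.

(** * Sums over the lattice *)

Section LatticeSums.
Variable C : numClosedFieldType.
Hypothesis sum_complete : forall (I : choiceType) (x : I -> C),
  absbounded x -> exists s, hassum x s.
Variable q : C.
Hypotheses (q_gt0 : 0 < q) (q_lt1 : q < 1).

Let q_neq0 : q != 0. Proof. by rewrite gt_eqF. Qed.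

Let exp_gt0 k : 0 < q ^+ k. Proof. exact: exprn_gt0. Qed.

Let exp_lt1 k : (0 < k)%N -> q ^+ k < 1.
Proof. by move=> k0; rewrite exprn_ilt1// ?ltW// -lt0n. Qed.

Let norm_exp_lt1 k : (0 < k)%N -> `|q ^+ k| < 1.
Proof. by move=> k0; rewrite gtr0_norm// exp_lt1. Qed.

Lemma qpoch_sqr (p : C) k : qpoch p p k * qpoch (- p) p k = qpoch (p ^+ 2) (p ^+ 2) k.
Proof.
elim: k => [|k IH]; first by rewrite !qpoch0 mulr1.
by rewrite !qpochS mulrACA IH -exprM mulnC exprM; ring.
Qed.

Lemma qpoch_double (p : C) k :
  qpoch p p k.*2 = qpoch p (p ^+ 2) k * qpoch (p ^+ 2) (p ^+ 2) k.
Proof.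
elim: k => [|k IH]; first by rewrite !qpoch0 mulr1.
rewrite doubleS !qpochS IH mulrACA -mulrA; congr (_ * _).
have -> : p ^+ 2 ^+ k = p ^+ k.*2 by rewrite -exprM mul2n.
by rewrite exprS; ring.
Qed.

Let c2 x : qpoch x (q ^+ 2) k @[k --> \oo] --> Etheta (q ^+ 2) x.
Proof. by apply: (cvg_qpoch sum_complete); rewrite ?exp_lt1. Qed.

Let c4 x : qpoch x (q ^+ 4) k @[k --> \oo] --> Etheta (q ^+ 4) x.
Proof. by apply: (cvg_qpoch sum_complete); rewrite ?exp_lt1. Qed.


Lemma Etheta_sqr : Etheta (q ^+ 2) (q ^+ 2) * Etheta (q ^+ 2) (- q ^+ 2) =
  Etheta (q ^+ 4) (q ^+ 4).
Proof.
have h : (fun k => qpoch (q ^+ 4) (q ^+ 4) k) @ \oo -->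
    Etheta (q ^+ 2) (q ^+ 2) * Etheta (q ^+ 2) (- q ^+ 2).
  rewrite (_ : (fun k => _) = fun k =>
      qpoch (q ^+ 2) (q ^+ 2) k * qpoch (- q ^+ 2) (q ^+ 2) k).
    by apply: cvgM; exact: c2.
  by apply/funext => k; rewrite qpoch_sqr -exprM.
exact: cvg_seq_unique h (@c4 (q ^+ 4)).
Qed.

(** Euler's identity between partitions into odd parts and into distinct parts,
    [1 / (p; p^2)_inf = (-p; p)_inf], at [p = q^2]. It follows by splitting [(p; p)_inf] in two
    ways. *)
Lemma epsi_Etheta : epsi (q ^+ 4) (q ^+ 2) = Etheta (q ^+ 2) (- q ^+ 2).
Proof.
have XZ : Etheta (q ^+ 2) (q ^+ 2) = Etheta (q ^+ 4) (q ^+ 2) * Etheta (q ^+ 4) (q ^+ 4).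
  have dbl : double @ \oo --> \oo.
    move=> A [N _ hN]; exists N => // k /= Nk; apply: hN => /=.
    by rewrite (leq_trans Nk)// -addnn leq_addr.
  have h : (fun k => qpoch (q ^+ 2) (q ^+ 2) k.*2) @ \oo -->
      Etheta (q ^+ 4) (q ^+ 2) * Etheta (q ^+ 4) (q ^+ 4).
    rewrite (_ : (fun k => _) = fun k =>
        qpoch (q ^+ 2) (q ^+ 4) k * qpoch (q ^+ 4) (q ^+ 4) k).
      by apply: cvgM; exact: c4.
    by apply/funext => k; rewrite qpoch_double -exprM.
  apply: (cvg_seq_unique _ h).
  exact: (cvg_comp double (fun k => qpoch (q ^+ 2) (q ^+ 2) k) dbl (@c2 (q ^+ 2))).
have e1 := Etheta_epsi sum_complete (exp_gt0 4) (exp_lt1 (isT : 0 < 4)%N)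
  (norm_exp_lt1 (isT : 0 < 2)%N).
have e2 := Etheta_epsi sum_complete (exp_gt0 4) (exp_lt1 (isT : 0 < 4)%N)
  (norm_exp_lt1 (isT : 0 < 4)%N).
have P0 : Etheta (q ^+ 4) (q ^+ 4) != 0.
  by apply/eqP => h; move/eqP: e2; rewrite h mul0r eq_sym oner_eq0.
have Z0 : Etheta (q ^+ 4) (q ^+ 2) != 0.
  by apply/eqP => h; move/eqP: e1; rewrite h mul0r eq_sym oner_eq0.
apply: (mulfI Z0); rewrite e1; apply: (mulfI P0); rewrite mulr1 -{1}Etheta_sqr XZ.
by ring.
Qed.

(** The 2 is the first factor of [(-1; q^2)_inf]; it will account for the two signs on the
    lattice. *)
Lemma b_constE : b_const (q ^+ 2) =
  2 * (1 - q ^+ 2) * Etheta (q ^+ 4) (q ^+ 4) * epsi (q ^+ 4) (q ^+ 2).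
Proof.
have h0 := exp_gt0 2; have h1 := exp_lt1 (isT : 0 < 2)%N.
rewrite /b_const !(qpoch_infE sum_complete h0 h1).
rewrite [Etheta _ (- 1)](Etheta_rec sum_complete h0 h1) mulrN1 epsi_Etheta.
rewrite -Etheta_sqr.
by ring.
Qed.

(* The zeros of [(p x; p)_inf] cut the lattice sum off at [N = 0]. *)
Lemma Etheta_lattice (p : C) (N : int) : 0 < p -> p < 1 ->
  Etheta p (p * p ^ N) = if N is Posz k then Etheta p p * e_coef p k else 0.
Proof.
move=> p0 p1; have pn0 : p != 0 by rewrite gt_eqF.
case: N => k.
  rewrite [in RHS](Etheta_qpoch sum_complete p0 p1 p k) mulrAC /e_coef.
  by rewrite divff ?mul1r// gt_eqF// qpochpp_gt0.
rewrite (Etheta_qpoch sum_complete p0 p1 _ k.+1) qpochS NegzE -exprnN exprS.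
by rewrite invfM mulrA divff// mul1r mulVf ?expf_neq0// subrr mulr0 mul0r.
Qed.

Definition gauss_moment (s : nat) : C := b_const (q ^+ 2) * qpoch (q ^+ 2) (q ^+ 4) s./2.

Let y (x : int * bool) : C := (-1) ^+ x.2 * q ^ (2 * x.1).

Definition lattice_term (s : nat) (x : int * bool) : C :=
  (1 - q ^+ 2) * q ^ (2 * x.1) * (y x ^+ s * Etheta (q ^+ 4) (q ^+ 4 * y x ^+ 2)).

Let term_int s : ~~ odd s -> forall x, lattice_term s x =
  (1 - q ^+ 2) * ((q ^+ (2 * s.+1)) ^ x.1 * Etheta (q ^+ 4) (q ^+ 4 * (q ^+ 4) ^ x.1)).
Proof.
move=> s_even [N b]; rewrite /lattice_term /y/= -[LHS]mulrA; congr (_ * _).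
have sgn k : ~~ odd k -> ((-1) ^+ b : C) ^+ k = 1.
  by move=> k_even; rewrite -signr_odd -exprM -signr_odd oddM (negPf k_even) andbF expr0.
rewrite !exprMn !sgn// !mul1r [LHS]mulrA; congr (_ * Etheta _ (_ * _)).
  by rewrite -exprS !exprnP !exprz_exp PoszM; congr (q ^ _); ring.
by rewrite !exprnP !exprz_exp mulrAC.
Qed.

(** Only [N = k >= 0] contributes, and there the infinite product is [(p; p)_inf / (p; p)_k] with
    [p = q^4], so the bilateral sum becomes the power series of [epsi]. *)
Let sum_int s : hassum
  (fun N : int => (q ^+ (2 * s.+1)) ^ N * Etheta (q ^+ 4) (q ^+ 4 * (q ^+ 4) ^ N))
  (Etheta (q ^+ 4) (q ^+ 4) * epsi (q ^+ 4) (q ^+ (2 * s.+1))) /\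
  absbounded
  (fun N : int => (q ^+ (2 * s.+1)) ^ N * Etheta (q ^+ 4) (q ^+ 4 * (q ^+ 4) ^ N)).
Proof.
have h0 := exp_gt0 4; have h1 := exp_lt1 (isT : 0 < 4)%N.
have t1 : `|q ^+ (2 * s.+1)| < 1 by rewrite norm_exp_lt1// muln_gt0.
set x := fun N : int => _.
have K : cancel Posz absz by [].
have x0 k : Posz (absz k) != k -> x k = 0.
  by case: k => [k /eqP//|k _]; rewrite /x Etheta_lattice// mulr0.
have xE : x \o Posz = fun k =>
    Etheta (q ^+ 4) (q ^+ 4) * (e_coef (q ^+ 4) k * (q ^+ (2 * s.+1)) ^+ k).
  by apply/funext => k; rewrite /x /= Etheta_lattice// -exprnP; ring.
split.
  by apply/(hassum_reindex K x0); rewrite xE; apply: hassumZ; exact: epsiP.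
by apply/(absbounded_reindex K x0); rewrite xE; apply: absboundedZ; exact: absbounded_e.
Qed.

Lemma hassum_bool (I : choiceType) (x : I -> C) s : hassum x s ->
  hassum (fun k : I * bool => x k.1) (2 * s).
Proof.
move=> hs; have one b : hassum (fun k : I * bool => if k.2 == b then x k.1 else 0) s.
  apply/(@hassum_reindex C I _ (fun i => (i, b)) fst) => //.
    by case=> i c /=; rewrite xpair_eqE eqxx/= eq_sym => /negPf ->.
  by move: hs; congr (hassum _ _); apply/funext => i /=; rewrite eqxx.
have := hassumD (one true) (one false); rewrite -mulr2n -[s *+ 2]mulr_natl.
by congr (hassum _ _); apply/funext => -[i []] /=; rewrite ?addr0 ?add0r.
Qed.

Lemma absbounded_bool (I : choiceType) (x : I -> C) : absbounded x ->
  absbounded (fun k : I * bool => x k.1).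
Proof.
move=> hs; have one b : absbounded (fun k : I * bool => if k.2 == b then x k.1 else 0).
  apply/(@absbounded_reindex C I _ (fun i => (i, b)) fst) => //.
    by case=> i c /=; rewrite xpair_eqE eqxx/= eq_sym => /negPf ->.
  by move: hs; congr (absbounded _); apply/funext => i /=; rewrite eqxx.
have := absboundedD (one true) (one false).
by congr (absbounded _); apply/funext => -[i []] /=; rewrite ?addr0 ?add0r.
Qed.

Lemma hassum_lattice_term s : ~~ odd s ->
  hassum (lattice_term s) (gauss_moment s) /\ absbounded (lattice_term s).
Proof.
move=> s_even; rewrite (funext (term_int s_even)).
have [hs bs] := sum_int s; split; last exact/absboundedZ/(absbounded_bool bs).
have := hassumZ (1 - q ^+ 2) (hassum_bool hs); congr (hassum _ _).
rewrite /gauss_moment b_constE.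
(* For even [s] the argument is [q^2] moved by [s / 2] steps of the base [q^4]; [epsi_qpoch] turns
   these steps into the factor [(q^2; q^4)_(s/2)]. *)
have -> : q ^+ (2 * s.+1) = q ^+ 2 * (q ^+ 4) ^+ s./2.
  rewrite -exprM -exprD; congr (_ ^+ _); have := odd_double_half s.
  by rewrite (negPf s_even) add0n -mul2n => {1}<-; rewrite mulnS mulnA.
rewrite (epsi_qpoch sum_complete (exp_gt0 4) (exp_lt1 (isT : 0 < 4)%N) _
  (norm_exp_lt1 (isT : 0 < 2)%N)).
by ring.
Qed.

(** The bound [M] is uniform in the shift. The shift will depend on the exponents of the remaining
    variables, and uniformity gives absolute convergence of the resulting double family. *)
Lemma lattice_term_shift s (S : int) : ~~ odd s ->
  hassum (fun x => lattice_term s (x.1 + S, x.2)) (gauss_moment s) /\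
  exists M : C, forall S (J : {fset int * bool}),
    \sum_(x <- J) `|lattice_term s (x.1 + S, x.2)| <= M.
Proof.
move=> /hassum_lattice_term[hs [M hM]].
have K T : cancel (fun x : int * bool => (x.1 + T, x.2)) (fun x => (x.1 - T, x.2)).
  by case=> N b /=; rewrite addrK.
split.
  apply: ((@hassum_reindex C _ _ _ _ (lattice_term s) (K S) _ _).1 hs).
  by case=> N b /=; rewrite subrK eqxx.
exists M => T J; pose f (x : int * bool) : int * bool := (x.1 + T, x.2).
rewrite (le_trans _ (hM (f @` J)%fset))//.
by rewrite big_imfset//= => x z _ _; exact: (can_inj (K T)).
Qed.

End LatticeSums.

(** * Coefficients of the discrete Hermite polynomials *)

Section HermiteCoefficients.
Variable C : numClosedFieldType.
Variable p : C.
Hypotheses (p_gt0 : 0 < p) (p_lt1 : p < 1).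

Let p_neq0 : p != 0. Proof. by rewrite gt_eqF. Qed.

Let qpp_neq0 k : qpoch p p k != 0.
Proof. by rewrite gt_eqF// qpochpp_gt0. Qed.

Let p2_gt0 : 0 < p ^+ 2. Proof. exact: exprn_gt0. Qed.

Let p2_lt1 : p ^+ 2 < 1. Proof. by rewrite exprn_ilt1// ltW. Qed.

Let qp2_neq0 k : qpoch (p ^+ 2) (p ^+ 2) k != 0.
Proof. by rewrite gt_eqF// qpochpp_gt0. Qed.

Let fac_neq0 k : 1 - p ^+ k.+1 != 0.
Proof. by rewrite gt_eqF// qfactor_gt0. Qed.

(** The coefficient of [z^k] in [htilde_(k + 2 j)]: for [l = k + 2 j] the exponent
    [-2 j l + j (2 j + 1)] of [p] equals [-(2 j k + 'C(2 j, 2))]. *)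
Let w (j k : nat) : C := (-1) ^+ j * qpoch p p (k + j.*2) /
  (p ^+ (j.*2 * k + 'C(j.*2, 2)) * (qpoch (p ^+ 2) (p ^+ 2) j * qpoch p p k)).

Lemma dhermite2_coef (a k : nat) : (dhermite2 p a)`_k =
  if (k <= a)%N && ~~ odd (a - k) then w (a - k)./2 k else 0.
Proof.
rewrite /dhermite2 coefZ coef_sum.
under eq_bigr do rewrite coefZ coefXn.
case: ifPn => [/andP[ka ev]|H]; last first.
  rewrite big1 ?mulr0// => j _; case: eqP => [kE|]; last by rewrite mulr0.
  have ja : (2 * j <= a)%N.
    by rewrite mul2n -[leqRHS](odd_double_half a) (leq_trans _ (leq_addl _ _))// leq_double -ltnS.
  by move: H; rewrite kE leq_subr subKn// mul2n odd_double.
pose j := (a - k)./2; have jE : j.*2 = (a - k)%N.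
  by rewrite -[RHS]odd_double_half (negPf ev).
have ja : (j < a./2.+1)%N by rewrite ltnS /j half_leq// leq_subr.
rewrite (bigD1 (Ordinal ja))//= big1 ?addr0; last first.
  move=> i ij; case: eqP => [kE|]; last by rewrite mulr0.
  have ia : (2 * i <= a)%N.
    by rewrite mul2n -[leqRHS](odd_double_half a) (leq_trans _ (leq_addl _ _))// leq_double -ltnS.
  move/eqP: ij; case; apply/val_inj => /=; apply: double_inj.
  by rewrite jE kE subKn// mul2n.
have aE : a = (k + j.*2)%N by rewrite jE subnKC.
rewrite -/j /w aE mul2n addnK eqxx mulr1.
rewrite (_ : - _ + _ = - Posz (j.*2 * k + 'C(j.*2, 2))%N); last first.
  have b2 : ('C(j.*2, 2) + j = j * j.*2)%N.
    by rewrite bin2; case: (j) => // m; rewrite -muln2 mulnAC muln2 doubleK; lia.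
  by move: b2; rewrite -muln2; nia.
rewrite -exprnN; field.
by rewrite !expf_neq0 ?qpp_neq0 ?qp2_neq0.
Qed.

Let bin2_double j : ('C(j.+1.*2, 2) = 'C(j.*2, 2) + (j.*2).*2.+1)%N.
Proof. by rewrite doubleS !binS !bin0 !bin1; lia. Qed.

Let w_rec j k : (1 - p ^+ k.+2) * w j k.+2 - p ^+ k * w j.+1 k =
  - p ^+ (k.+1 + j.*2.+1) * w j.+1 k.+1.
Proof.
rewrite /w.
have -> : (k + j.+1.*2 = (k + j.*2).+2)%N by lia.
have -> : (k.+2 + j.*2 = (k + j.*2).+2)%N by lia.
have -> : (k.+1 + j.+1.*2 = (k + j.*2).+3)%N by lia.
have -> : (k.+1 + j.*2.+1 = (k + j.*2).+2)%N by lia.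
rewrite !bin2_double [qpoch p p (_).+3]qpochS [qpoch (p ^+ 2) _ j.+1]qpochS.
rewrite [qpoch p p k.+2]qpochS [qpoch p p k.+1]qpochS.
move: (qpoch p p (k + j.*2).+2) => A.
move: (qpoch _ _ j) (qp2_neq0 j) => D D0.
have -> : (j.*2 * k.+2 + 'C(j.*2, 2) = (j.*2 * k + 'C(j.*2, 2)) + j.*2.*2)%N by lia.
have -> : (j.+1.*2 * k + ('C(j.*2, 2) + j.*2.*2.+1) =
  (j.*2 * k + 'C(j.*2, 2)) + j.*2.*2 + k.*2.+1)%N by lia.
have -> : (j.+1.*2 * k.+1 + ('C(j.*2, 2) + j.*2.*2.+1) =
  (j.*2 * k + 'C(j.*2, 2)) + j.*2.*2 + k.*2.+1 + j.*2.+2)%N by lia.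
rewrite -[p ^+ 2 ^+ j]exprM mul2n -!addnn !exprD !exprS !exprD.
have := fac_neq0 k; have := fac_neq0 k.+1; have := fac_neq0 (j + j).+1.
rewrite !exprS !exprD.
have := qpp_neq0 k; move: (qpoch p p k) => B.
have := expf_neq0 j p_neq0; have := expf_neq0 k p_neq0.
have := expf_neq0 (j * k + j * k) p_neq0; have := expf_neq0 'C(j + j, 2) p_neq0.
move=> h1 h2 h3 h4 h5 h6 h7 h8; field.
by rewrite -[p * p * _]mulrA h8 h5 h6 D0 h4 p_neq0 h3 h1 h7 expf_neq0.
Qed.

Let w_rec0 j : (1 - p) * w j 1 = - p ^+ j.*2.+1 * w j.+1 0.
Proof.
rewrite /w !muln1 !muln0 !add0n !add1n bin2_double doubleS [qpoch p p _.+2]qpochS.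
rewrite [qpoch (p ^+ 2) _ j.+1]qpochS [qpoch p p 1]qpochS !qpoch0 mul1r expr0 mulr1.
move: (qpoch p p _.+1) => A; move: (qpoch _ _ j) (qp2_neq0 j) => D D0.
rewrite -[p ^+ 2 ^+ j]exprM mul2n -!addnn.
have := fac_neq0 (j + j).+1; have := fac_neq0 0.
rewrite !(exprS, exprD) expr0 mulr1.
have := expf_neq0 j p_neq0; have := expf_neq0 'C(j + j, 2) p_neq0.
move=> h1 h2 h3 h4; field.
by rewrite h3 D0 h1 h2 p_neq0 -[p * p * _]mulrA h4.
Qed.

Let w0 k : w 0 k = 1.
Proof. by rewrite /w double0 mul0n addn0 expr0 !qpoch0 !mul1r divff. Qed.

Let u a k : C := (dhermite2 p a)`_k.

(** The coefficient of [z^(k+1)] in the backward shift relation [(h_a(z) - h_a(p z)) / z - z h_a(p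
    z) = - p^a h_(a+1)(z)]; the constant coefficient is [u_rec0]. *)
Let u_rec a k : (1 - p ^+ k.+2) * u a k.+2 - p ^+ k * u a k = - p ^+ a * u a.+1 k.+1.
Proof.
rewrite /u !dhermite2_coef ltnS subSS.
have [ka|ka] := leqP k a; last first.
  have -> : (k.+1 < a)%N = false by lia.
  by rewrite /= !mulr0 subr0.
have [ev|od] := boolP (odd (a - k)).
  rewrite !mulr0; case: ifP => [/andP[k2 /negP[]]|_]; last by rewrite mulr0 subr0.
  by move: ev; rewrite (_ : (a - k = (a - k.+2).+2)%N) /= ?negbK//; lia.
have [j jE] : exists j, a = (k + j.*2)%N.
  exists (a - k)./2; have := odd_double_half (a - k); rewrite (negPf od) add0n => ->.
  by rewrite subnKC.
rewrite /= jE addKn; case: j {jE} => [|j].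
  by rewrite addn0 ltnNge leqnSn/= mulr0 sub0r !w0 !mulr1.
have -> : (k + j.+1.*2 - k.+2 = j.*2)%N by lia.
have -> : (k + j.+1.*2 = k.+1 + j.*2.+1)%N by lia.
rewrite (_ : (k.+1 < _)%N); last by lia.
by rewrite /= !odd_double /= !doubleK w_rec.
Qed.

Let u_rec0 a : (1 - p) * u a 1 = - p ^+ a * u a.+1 0.
Proof.
rewrite /u !dhermite2_coef/= negbK.
case: a => [|a]; first by rewrite !mulr0.
rewrite subn1/=; case: ifP => [ev|_]; last by rewrite !mulr0.
have [j ->] : exists j, a = j.*2.
  by exists a./2; have := odd_double_half a; rewrite (negPf ev).
by rewrite doubleK w_rec0.
Qed.

Let g m : C := subst_sq (e_coef (p ^+ 2)) (-1) m.

Let g_rec m : (1 - p ^+ m.+2) * g m.+2 = - g m.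
Proof.
rewrite /g /subst_sq/= negbK; case: ifPn => [_|ev]; first by rewrite mulr0 oppr0.
have := e_coefS p2_gt0 p2_lt1 m./2; rewrite -exprM mul2n doubleS.
have := odd_double_half m; rewrite (negPf ev) add0n => -> <-.
by rewrite [(-1) ^+ _.+1]exprS; ring.
Qed.

Definition hermite_sum a e : C := \sum_(k < e.+1) u a k * g (e - k).

(* Multiplying by [1 - p^(e+1) = (1 - p^k) + p^k (1 - p^(e+1-k))] splits the sum into
   the two halves of the backward shift relation of the Hermite polynomials. *)
Lemma hermite_sum_rec a e :
  (1 - p ^+ e.+1) * hermite_sum a e.+1 = - p ^+ a * hermite_sum a.+1 e.
Proof.
have g1 : g 1 = 0 by [].
have split : (1 - p ^+ e.+1) * hermite_sum a e.+1 =
    \sum_(k < e.+2) (1 - p ^+ k) * u a k * g (e.+1 - k) +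
    \sum_(k < e.+2) p ^+ k * u a k * ((1 - p ^+ (e.+1 - k)) * g (e.+1 - k)).
  rewrite mulr_sumr -big_split/=; apply: eq_bigr => k _.
  have -> : p ^+ e.+1 = p ^+ k * p ^+ (e.+1 - k) by rewrite -exprD subnKC// -ltnS.
  by ring.
rewrite {}split big_ord_recl expr0 subrr !mul0r add0r.
rewrite [X in _ + X]big_ord_recr/= subnn expr0 subrr mul0r mulr0 addr0.
rewrite [X in _ + X]big_ord_recr/= subSnn g1 !mulr0 addr0.
rewrite big_ord_recl/= /hermite_sum big_ord_recl/= mulrDr addrAC -addrA.
rewrite [X in X + _](_ : _ = - p ^+ a * (u a.+1 0 * g (e - 0))); last first.
  by rewrite /bump/= expr1 u_rec0 mulrA subn0 subSS subn0.
congr (_ + _); rewrite addrC -big_split/= mulr_sumr; apply: eq_bigr => k _.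
rewrite /bump/= !add1n subSS.
have ke : (k < e)%N by [].
have -> : (e.+1 - k = (e - k.+1).+2)%N by lia.
rewrite g_rec [RHS]mulrA -u_rec.
by ring.
Qed.

(** A Rodrigues formula read on coefficients: [p^'C(a, 2) h_a(z) e_(p^2)(-z^2)] is [(-1)^a] times
    the [a]-th iterate of [f(z) -> (f(z) - f(p z)) / z] on [e_(p^2)(-z^2)]. *)
Lemma hermite_sum_closed a e : p ^+ 'C(a, 2) * hermite_sum a e * qpoch p p e =
  (-1) ^+ a * qpoch p p (e + a) * g (e + a).
Proof.
elim: a e => [|a IH] e.
  rewrite expr0 !mul1r addn0 /hermite_sum big_ord_recl/= /u dhermite2_coef/= w0 subn0.
  rewrite big1 ?addr0 ?mul1r 1?mulrC// => k _.
  by rewrite dhermite2_coef mul0r.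
rewrite binS bin1 exprD -[p ^+ 'C(a, 2) * _ * _]mulrA.
have -> : p ^+ a * hermite_sum a.+1 e = - ((1 - p ^+ e.+1) * hermite_sum a e.+1).
  by rewrite hermite_sum_rec mulNr opprK.
transitivity (- (p ^+ 'C(a, 2) * hermite_sum a e.+1 * qpoch p p e.+1)).
  by rewrite qpochS -exprS; ring.
by rewrite IH addnS addSn exprS; ring.
Qed.

End HermiteCoefficients.

Lemma hermite_moment (C : numClosedFieldType) (q : C) a e : 0 < q -> q < 1 ->
  'i ^+ e / qpoch (q ^+ 2) (q ^+ 2) e *
    (if odd (a + e) then 0 else qpoch (q ^+ 2) (q ^+ 4) (a + e)./2) =
  q ^+ (a ^ 2 - a) * 'i ^+ a *
    \sum_(k < e.+1) (dhermite2 (q ^+ 2) a)`_k * subst_sq (e_coef (q ^+ 4)) (-1) (e - k).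
Proof.
move=> q0 q1; have p0 : 0 < q ^+ 2 by exact: exprn_gt0.
have p1 : q ^+ 2 < 1 by rewrite exprn_ilt1// ltW.
have q4 : q ^+ 2 ^+ 2 = q ^+ 4 by rewrite -exprM.
have C2 : (2 * 'C(a, 2) = a ^ 2 - a)%N.
  by elim: (a) => // b IH; rewrite binS bin1 mulnDr IH -!mulnn; nia.
have := hermite_sum_closed p0 p1 a e; rewrite /hermite_sum q4.
rewrite -[q ^+ 2 ^+ 'C(a, 2)]exprM C2; set S := \sum_(_ < _) _.
have Q0 : qpoch (q ^+ 2) (q ^+ 2) e != 0 by rewrite gt_eqF// qpochpp_gt0.
move=> H; apply: (mulIf Q0); rewrite mulrAC divfK//.
have -> : q ^+ (a ^ 2 - a) * 'i ^+ a * S * qpoch (q ^+ 2) (q ^+ 2) e =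
    'i ^+ a * (q ^+ (a ^ 2 - a) * S * qpoch (q ^+ 2) (q ^+ 2) e) by ring.
rewrite H addnC /subst_sq; case: ifPn => [_|ev]; first by rewrite !mulr0.
pose m := (e + a)./2; have mE : (e + a = m.*2)%N.
  by have := odd_double_half (e + a); rewrite (negPf ev).
rewrite -/m mE qpoch_double q4 /e_coef.
have m0 : qpoch (q ^+ 4) (q ^+ 4) m != 0.
  by rewrite gt_eqF// qpochpp_gt0 ?exprn_gt0// exprn_ilt1// ltW.
have i4 : 'i ^+ 4 = 1 :> C by rewrite (exprM _ 2 2) sqrCi sqrrN expr1n.
(* Since [e + a = 2 m], the sign [(-1)^a] of the Rodrigues formula and the sign [(-1)^m] of the
   Gaussian are exactly the quotient of [i^e] by [i^a]. *)
have -> : 'i ^+ e = 'i ^+ a * ((-1) ^+ a * (-1) ^+ m) :> C.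
  rewrite -sqrCi -!exprM -!exprD.
  have -> : (a + (2 * a + 2 * m) = 4 * a + e)%N by lia.
  by rewrite exprD exprM i4 expr1n mul1r.
by field.
Qed.

(** * Normal ordering *)

Section TwistedProducts.
Variables (C : numClosedFieldType) (n : nat) (q : C).
Implicit Types (e d : mexp n) (f g : qseries C n).

Definition esingle (j : 'I_n) (k : nat) : mexp n := [ffun i => if i == j then k else 0%N].
Definition eset (j : 'I_n) (k : nat) (e : mexp n) : mexp n :=
  [ffun i => if i == j then k else e i].

Variable t : mexp n -> mexp n -> nat.

Lemma mul_in_gen (j : 'I_n) (f : nat -> C) g e :
  twisted_mul t q (in_gen j f) g e =
  \sum_(k < (e j).+1) q ^+ t (esingle j k) (eset j (e j - k) e) * f k *
    g (eset j (e j - k) e).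
Proof.
rewrite /twisted_mul.
pose P (d : {dffun forall i : 'I_n, 'I_(e i).+1}) :=
  [forall i, (i != j) ==> (d i == 0%N :> nat)].
rewrite (bigID P)/= [X in _ + X]big1 ?addr0; last first.
  move=> d dP; rewrite [in_gen _ _ _]ifF ?mulr0 ?mul0r//.
  by apply: contraNF dP => /forallP h; apply/forallP => i; have := h i; rewrite ffunE.
pose h (k : 'I_(e j).+1) : {dffun forall i : 'I_n, 'I_(e i).+1} :=
  [ffun i => inord (if i == j then nat_of_ord k else 0)].
have hE k i : h k i = (if i == j then nat_of_ord k else 0%N) :> nat.
  rewrite ffunE inordK//; case: eqP => // ->; exact: ltn_ord.
rewrite (reindex_onto h (fun d : {dffun forall i : 'I_n, 'I_(e i).+1} => d j))/=; last first.
  move=> d /forallP dP; apply/ffunP => i; apply/val_inj; rewrite /= hE.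
  by case: eqP => [->//|/eqP ij]; have := dP i; rewrite ij => /eqP.
apply: eq_big => [k|k _].
  apply/andP; split; last by apply/eqP/val_inj; rewrite /= hE eqxx.
  by apply/forallP => i; rewrite hE; apply/implyP => /negPf ->.
have -> : [ffun i => nat_of_ord (h k i)] = esingle j k.
  by apply/ffunP => i; rewrite [LHS]ffunE hE ffunE.
have -> : [ffun i => (e i - h k i)%N] = eset j (e j - k) e.
  by apply/ffunP => i; rewrite [LHS]ffunE hE ffunE; case: eqP => [->|]; rewrite ?subn0.
congr (_ * _ * _); rewrite /in_gen ifT ?ffunE ?eqxx//.
by apply/forallP => i; apply/implyP => /negPf ij; rewrite ffunE ij.
Qed.

Lemma mul_monomial f d e : twisted_mul t q f (monomial C d) e =
  if [forall i, (d i <= e i)%N] then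
    q ^+ t [ffun i => (e i - d i)%N] d * f [ffun i => (e i - d i)%N]
  else 0.
Proof.
rewrite /twisted_mul; case: ifPn => [/forallP de|H]; last first.
  rewrite big1// => b _; rewrite /monomial; case: eqP => [E|]; last by rewrite mulr0.
  by case/negP: H; apply/forallP => i; rewrite -E ffunE leq_subr.
pose h : {dffun forall i : 'I_n, 'I_(e i).+1} := [ffun i => inord (e i - d i)].
have hE i : h i = (e i - d i)%N :> nat by rewrite ffunE inordK// ltnS leq_subr.
rewrite (bigD1 h)//= [X in _ + X]big1 ?addr0.
  have -> : [ffun i => nat_of_ord (h i)] = [ffun i => (e i - d i)%N].
    by apply/ffunP => i; rewrite [LHS]ffunE hE ffunE.
  have -> : [ffun i => (e i - h i)%N] = d.
    by apply/ffunP => i; rewrite ffunE hE subKn.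
  by rewrite /monomial eqxx mulr1.
move=> b bh; rewrite /monomial; case: eqP => [E|]; last by rewrite mulr0.
case/eqP: bh; apply/ffunP => i; apply/val_inj; rewrite /= hE -E ffunE subKn//.
by rewrite -ltnS.
Qed.

Lemma mul_in_gen2 (j : 'I_n) (f g : nat -> C) :
  (forall k l, t (esingle j k) (esingle j l) = 0%N) ->
  twisted_mul t q (in_gen j f) (in_gen j g) =
  in_gen j (fun m => \sum_(k < m.+1) f k * g (m - k)%N).
Proof.
move=> t0; apply/funext => e; rewrite mul_in_gen {2}/in_gen.
case: ifPn => [/forallP h|h]; last first.
  rewrite big1// => k _; rewrite /in_gen ifF ?mulr0//.
  apply: contraNF h => /forallP h; apply/forallP => i; have := h i.
  by rewrite ffunE; case: eqP.
apply: eq_bigr => k _.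
have -> : eset j (e j - k) e = esingle j (e j - k).
  apply/ffunP => i; rewrite !ffunE; case: eqP => // /eqP ij.
  by apply/eqP; have := h i; rewrite ij.
rewrite t0 expr0 mul1r /in_gen ifT ?ffunE ?eqxx//.
by apply/forallP => i; apply/implyP => /negPf ij; rewrite ffunE ij.
Qed.

(** [T] accumulates the power of [q] as factors of higher index are multiplied on the left.
    Decreasing order opposes the normal order of the algebra A, where [T e = twistA e e], and agrees
    with that of D, where [T = 0]. *)
Lemma in_gen_prod (T : mexp n -> nat) (g : 'I_n -> nat -> C) (s : seq 'I_n) :
  sorted (fun i j : 'I_n => (j < i)%N) s ->
  T (mexp0 n) = 0%N ->
  (forall (j : 'I_n) e, (forall i : 'I_n, (j <= i)%N -> e i = 0%N) -> forall k,
     T (eset j k e) = (t (esingle j k) e + T e)%N) ->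
  forall e, (\big[twisted_mul t q/@qone C n]_(j <- s) in_gen j (g j)) e =
    if [forall i, (i \notin s) ==> (e i == 0%N)] then
      q ^+ T e * \prod_(j <- s) g j (e j)
    else 0.
Proof.
move=> + T0 TS; elim: s => [_|j s IH] /=.
  move=> e; rewrite !big_nil /qone /monomial mulr1.
  have -> : [forall i, (i \notin [::]) ==> (e i == 0%N)] = (e == mexp0 n).
    apply/forallP/eqP => [h|-> i]; last by rewrite ffunE.
    by apply/ffunP => i; rewrite ffunE; apply/eqP; exact: h.
  by case: eqP => [->|//]; rewrite T0 expr0.
move=> pjs; have js i : i \in s -> (i < j)%N.
  move: pjs; rewrite path_sortedE; last by move=> x y z /= yx zy; exact: ltn_trans zy yx.
  by case/andP => /allP h _; exact: h.
have jNs : j \notin s by apply/negP => /js; rewrite ltnn.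
move=> e; rewrite !big_cons mul_in_gen.
have {}IH := IH (path_sorted pjs).
rewrite big_ord_recr/= subnn IH big1 ?add0r; last first.
  move=> k _; rewrite IH ifF ?mulr0//; apply/negP => /forallP/(_ j).
  by rewrite jNs ffunE eqxx subn_eq0 leqNgt ltn_ord.
have condE : [forall i, (i \notin s) ==> (eset j 0 e i == 0%N)] =
    [forall i, (i \notin j :: s) ==> (e i == 0%N)].
  apply: eq_forallb => i; rewrite inE ffunE.
  by have [ij|ij] := eqVneq i j; rewrite //= ?eqxx ?implybT.
rewrite condE; case: ifPn => [/forallP h|_]; last by rewrite mulr0.
have h0 (i : 'I_n) : (j <= i)%N -> eset j 0 e i = 0%N.
  rewrite leq_eqVlt ffunE => /predU1P[ji|ji]; first by rewrite -(val_inj ji) eqxx.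
  case: eqP => // /eqP ij; apply/eqP; apply: (implyP (h i)).
  by rewrite inE negb_or ij; apply/negP => /js; rewrite ltnNge ltnW.
have -> : T e = (t (esingle j (e j)) (eset j 0 e) + T (eset j 0 e))%N.
  rewrite -TS//; congr (T _); apply/ffunP => i; rewrite !ffunE.
  by case: eqP => // ->.
rewrite exprD (_ : \prod_(i <- s) g i (eset j 0 e i) = \prod_(i <- s) g i (e i)); first by ring.
rewrite big_seq [RHS]big_seq; apply: eq_bigr => i /js ij; rewrite ffunE.
by case: eqP => // ijE; rewrite ijE ltnn in ij.
Qed.

End TwistedProducts.

Section NormalOrder.
Variables (C : numClosedFieldType) (n : nat) (q : C).

Let rev_enum_sorted : sorted (fun i j : 'I_n => (j < i)%N) (rev (enum 'I_n)).
Proof.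
rewrite rev_sorted.
by have := @sorted_map _ _ (@nat_of_ord n) ltn (enum 'I_n); rewrite val_enum_ord iota_ltn_sorted.
Qed.

Lemma twist_single (r : rel nat) (j : 'I_n) k (e : mexp n) :
  (\sum_(i < n) \sum_(l < n | r i l) esingle j k i * e l =
   \sum_(l < n | r j l) k * e l)%N.
Proof.
rewrite (bigD1 j)//= [X in (_ + X)%N]big1 ?addn0.
  by apply: eq_bigr => l _; rewrite ffunE eqxx.
by move=> i ij; rewrite big1// => l _; rewrite ffunE (negPf ij).
Qed.

Lemma twistA_single (j : 'I_n) k l : twistA (esingle j k) (esingle j l) = 0%N :> nat.
Proof.
rewrite /twistA (twist_single (fun i l => l < i)%N) big1// => i ij.
by rewrite ffunE; case: eqP => [iE|]; rewrite ?muln0//; rewrite iE ltnn in ij.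
Qed.

Lemma twistD_single (j : 'I_n) k l : twistD (esingle j k) (esingle j l) = 0%N :> nat.
Proof.
rewrite /twistD (twist_single (fun i l => i < l)%N) big1// => i ij.
by rewrite ffunE; case: eqP => [iE|]; rewrite ?muln0//; rewrite iE ltnn in ij.
Qed.

Lemma twistA_eset (j : 'I_n) (e : mexp n) k : (forall i : 'I_n, (j <= i)%N -> e i = 0%N) ->
  twistA (eset j k e) (eset j k e) = (twistA (esingle j k) e + twistA e e)%N.
Proof.
move=> h; rewrite {2}/twistA (twist_single (fun i l => l < i)%N) /twistA.
rewrite (bigD1 j)//= [X in _ = (_ + X)%N](bigD1 j)//=.
rewrite [X in _ = (_ + (X + _))%N]big1 ?add0n; last by move=> i _; rewrite h.
congr (_ + _)%N.
  apply: eq_bigr => l lj; rewrite !ffunE eqxx; case: eqP => // lE.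
  by rewrite lE ltnn in lj.
apply: eq_bigr => i /negPf ij; have [ji|ji] := leqP j i.
  by rewrite !big1// => l _; rewrite ?ffunE ?ij h.
apply: eq_bigr => l li; rewrite !ffunE ij; case: eqP => // lE.
by rewrite lE ltnNge ltnW in li.
Qed.

Definition pow_coef (f : nat -> C) (s m : nat) : C :=
  if (s <= m)%N then f (m - s)%N else 0.

Lemma pow_coefE (f : nat -> C) (s m : nat) :
  \sum_(k < m.+1) f k * (m - k == s)%N%:R = pow_coef f s m.
Proof.
rewrite /pow_coef; case: leqP => [sm|ms]; last first.
  by rewrite big1// => k _; rewrite (_ : (m - k == s)%N = false) ?mulr0//; lia.
have h : (m - s < m.+1)%N by rewrite ltnS leq_subr.
rewrite (bigD1 (Ordinal h))//= subKn// eqxx mulr1 big1 ?addr0// => k kh.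
rewrite (_ : (m - k == s)%N = false) ?mulr0//; apply/eqP => E.
case/eqP: kh; apply/val_inj => /=; rewrite -E subKn// -ltnS.
exact: ltn_ord.
Qed.

Let all_mem (e : mexp n) : [forall i, (i \notin rev (enum 'I_n)) ==> (e i == 0%N)].
Proof. by apply/forallP => i; rewrite mem_rev mem_enum. Qed.

Let prod_rev_enum (F : 'I_n -> C) : \prod_(j <- rev (enum 'I_n)) F j = \prod_j F j.
Proof. by rewrite (perm_big (enum 'I_n)) ?big_enum// perm_rev. Qed.

Lemma gaussNE (a : 'I_n -> nat) (e : mexp n) : gaussN q a e = q ^+ twistA e e *
  \prod_j pow_coef (subst_sq (E_coef (q ^+ 4)) (- q ^+ 4)) (a j) (e j).
Proof.
rewrite /gaussN (eq_bigr (fun j => in_gen j (fun m =>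
    pow_coef (subst_sq (E_coef (q ^+ 4)) (- q ^+ 4)) (a j) m))).
  rewrite (in_gen_prod q (T := fun e => twistA e e) _ rev_enum_sorted).
  - by rewrite all_mem prod_rev_enum.
  - by rewrite /twistA big1// => i _; rewrite big1// => j _; rewrite ffunE.
  - by move=> j d h k; exact: twistA_eset.
move=> j _; rewrite /Defs.mulA mul_in_gen2; last exact: twistA_single.
by congr in_gen; apply/funext => m; rewrite pow_coefE.
Qed.

Lemma hermite_gauss_prodE (a : 'I_n -> nat) (e : mexp n) : hermite_gauss_prod q a e =
  \prod_j \sum_(k < (e j).+1) (dhermite2 (q ^+ 2) (a j))`_k *
    subst_sq (e_coef (q ^+ 4)) (-1) (e j - k).
Proof.
rewrite /hermite_gauss_prod (eq_bigr (fun j => in_gen j (fun m =>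
    \sum_(k < m.+1) (dhermite2 (q ^+ 2) (a j))`_k *
      subst_sq (e_coef (q ^+ 4)) (-1) (m - k)))).
  rewrite (in_gen_prod q (T := fun=> 0%N) _ rev_enum_sorted).
  - by rewrite all_mem prod_rev_enum expr0 mul1r.
  - by [].
  - move=> j d h k; rewrite addn0 /twistD (twist_single (fun i l => i < l)%N).
    by rewrite big1// => i ji; rewrite h ?muln0// ltnW.
by move=> j _; rewrite /mulD mul_in_gen2//; exact: twistD_single.
Qed.

Lemma gaussN_monomialE (a : 'I_n -> nat) (d e : mexp n) :
  Defs.mulA q (gaussN q a) (monomial C d) e =
  \prod_i (pow_coef (subst_sq (E_coef (q ^+ 4)) (- q ^+ 4)) (a i + d i) (e i) *
    q ^+ ((e i - d i) * \sum_(j < n | (j < i)%N) e j)).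
Proof.
rewrite /Defs.mulA mul_monomial; case: ifPn => [/forallP de|]; last first.
  rewrite negb_forall => /existsP[k]; rewrite -ltnNge => ed.
  by rewrite (bigD1 k)//= /pow_coef leqNgt ltn_addl// !mul0r.
rewrite gaussNE mulrA -exprD big_split/=; rewrite mulrC; congr (_ * _).
  apply: eq_bigr => i _; rewrite ffunE /pow_coef addnC.
  by rewrite -leq_subRL// subnDA.
(* The twist [twistA (e - d) (e - d)] of the Gaussian and the twist [twistA (e - d) d] of the
   monomial add up to [twistA (e - d) e]. *)
rewrite prodrXr; congr (q ^+ _); rewrite -big_split/=; apply: eq_bigr => i _.
rewrite -big_split/= big_distrr/=; apply: eq_bigr => j _.
by rewrite !ffunE -mulnDr subnKC.
Qed.

End NormalOrder.

(** * The chain of integrals of the Gaussian *)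

Section GaussianChain.
Variables (C : numClosedFieldType) (n : nat).
Hypothesis sum_complete : forall (I : choiceType) (x : I -> C),
  absbounded x -> exists s, hassum x s.
Hypothesis row_connected : connected [set: 'rV[C]_n].
Variables (q : C) (a : 'I_n -> nat) (e : mexp n).
Hypotheses (q_gt0 : 0 < q) (q_lt1 : q < 1).

Let q_neq0 : q != 0. Proof. by rewrite gt_eqF. Qed.
Let qX_neq0 k : q ^+ k != 0. Proof. exact: expf_neq0. Qed.
Let q4_gt0 : 0 < q ^+ 4. Proof. exact: exprn_gt0. Qed.
Let q4_lt1 : q ^+ 4 < 1. Proof. by rewrite exprn_ilt1// ltW. Qed.

Let s (i : 'I_n) : nat := (a i + e i)%N.
Let gam (k : 'I_n) : C := q ^+ (k + \sum_(j < n | (k < j)%N) a j).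
Let f : qseries C n := Defs.mulA q (gaussN q a) (monomial C e).
Let c (r m : nat) : C := pow_coef (subst_sq (E_coef (q ^+ 4)) (- q ^+ 4)) r m.

Let c_neq0 r m : c r m != 0 -> (r <= m)%N /\ ~~ odd (m - r).
Proof.
rewrite /c /pow_coef; case: leqP => [rm|]; last by rewrite eqxx.
by rewrite /subst_sq; case: ifP; rewrite ?eqxx.
Qed.

Let hassum_c r (x : C) :
  hassum (fun m => c r m * x ^+ m) (x ^+ r * Etheta (q ^+ 4) (q ^+ 4 * x ^+ 2)) /\
  absbounded (fun m => c r m * x ^+ m).
Proof.
have K : cancel (fun k => (r + k.*2)%N) (fun m => (m - r)./2).
  by move=> k; rewrite addKn doubleK.
set X := fun m => c r m * x ^+ m.
have X0 k : (r + (k - r)./2.*2)%N != k -> X k = 0.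
  move=> h; rewrite /X; have [->|/c_neq0[rk ev]] := eqVneq (c r k) 0; first by rewrite mul0r.
  case/eqP: h; have := odd_double_half (k - r); rewrite (negPf ev) add0n => ->.
  by rewrite subnKC.
have XE : X \o (fun k => (r + k.*2)%N) =
    fun k => x ^+ r * (E_coef (q ^+ 4) k * (- (q ^+ 4 * x ^+ 2)) ^+ k).
  apply/funext => k; rewrite /X /c /pow_coef /= leq_addr addKn /subst_sq odd_double doubleK.
  rewrite exprD -mul2n [x ^+ (2 * k)]exprM -[- (q ^+ 4 * x ^+ 2)]mulNr.
  by rewrite [(_ * _) ^+ k]exprMn; ring.
split.
  by apply/(hassum_reindex K X0); rewrite XE; apply: hassumZ; exact: EthetaP.
by apply/(absbounded_reindex K X0); rewrite XE; apply: absboundedZ; exact: absbounded_E.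
Qed.

(* Up to the constant [K k] below, the coefficients of the series that remains after the
   first [k] variables have been integrated out. *)
Let beta (k : nat) (m : mexp n) : C :=
  if [forall i : 'I_n, (i < k)%N ==> (m i == 0%N)] then
    \prod_(i < n | (k <= i)%N) (c (s i) (m i) *
      (q ^+ ((m i - e i) * \sum_(j < n | (k <= j < i)%N) m j) / q ^+ (k * (m i - e i))))
  else 0.

Let beta0 : beta 0 = f.
Proof.
apply/funext => m; rewrite /beta /f gaussN_monomialE ifT; last exact/forallP.
by apply: eq_bigr => i _; rewrite mul0n expr0 divr1.
Qed.

Let D (l : 'I_n) (m : mexp n) : nat := \sum_(i < n | (l < i)%N) (m i - e i).

(** In the exponent [(m l).+1 * D l m], the part [m l * D l m] is the coupling of [l] with the later
    variables. The extra [D l m] pays for raising their denominators from [q^(l d)] to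
    [q^((l + 1) d)]; the measure absorbs it in [TE]. *)
Let beta_succ (l : 'I_n) (m : mexp n) : beta l m =
  c (s l) (m l) * (q ^+ ((m l).+1 * D l m) / q ^+ (l * (m l - e l))) *
  beta l.+1 (eset l 0 m).
Proof.
rewrite /beta.
have -> : [forall i : 'I_n, (i < l.+1)%N ==> (eset l 0 m i == 0%N)] =
    [forall i : 'I_n, (i < l)%N ==> (m i == 0%N)].
  apply: eq_forallb => i; rewrite ffunE; have [->|il] := eqVneq i l.
    by rewrite eqxx implybT ltnn.
  by rewrite ltnS leq_eqVlt val_eqE (negPf il).
case: ifP => _; last by rewrite mulr0.
rewrite (bigD1 l)//= [X in q ^+ (_ * X)]big1 ?muln0 ?expr0; last first.
  by move=> j /andP[lj jl]; rewrite leqNgt jl in lj.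
rewrite /D big_distrr/= -prodrXr mul1r.
rewrite -!mulrA; congr (_ * _); rewrite mulrCA; congr (_ * _).
rewrite [X in _ = X * _](eq_bigl (fun i : 'I_n => (l <= i)%N && (i != l))); last first.
  by move=> i; rewrite ltn_neqAle andbC eq_sym.
rewrite [X in _ = _ * X](eq_bigl (fun i : 'I_n => (l <= i)%N && (i != l))); last first.
  by move=> i; rewrite ltn_neqAle andbC eq_sym.
rewrite -big_split/=; apply: eq_bigr => i /andP[li il].
rewrite ffunE (negPf il) [RHS]mulrCA; congr (_ * _).
have li' : (l < i)%N by rewrite ltn_neqAle eq_sym il.
rewrite (bigD1 l)/=; last by rewrite leqnn.
rewrite (eq_bigl (fun j : 'I_n => (l < j < i)%N)); last first.
  by move=> j; rewrite [in RHS]ltn_neqAle andbAC [(_ != _) && _]andbC eq_sym.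
rewrite (eq_bigr (fun j : 'I_n => eset l 0 m j)); last first.
  by move=> j /andP[lj _]; rewrite ffunE; case: eqP => // E; rewrite E ltnn in lj.
move: (m i - e i)%N => d; rewrite mulnDr !mulSn !exprD [(m l * d)%N]mulnC; field.
by rewrite !qX_neq0.
Qed.

(** The coupling powers of [q] are at most 1, so the terms are dominated by a product of
    one-variable series at [z_i / q^k], which converge everywhere. *)
Let absbounded_beta k z : absbounded (fun m => beta k m * monom_at z m).
Proof.
pose y (i : 'I_n) (t : nat) : C :=
  if (i < k)%N then (t == 0%N)%:R else c (s i) t * (z 0 i / q ^+ k) ^+ t.
have yb i : absbounded (y i).
  rewrite /y; case: ltnP => _; last exact: (hassum_c _ _).2.
  by apply: (@absbounded_fin C _ _ [fset 0%N]%fset) => t; rewrite inE => /negPf ->.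
apply: absbounded_le (absbounded_mexp yb) => m.
rewrite /beta; case: ifP => [/forallP h|_]; last by rewrite mul0r normr0.
rewrite /monom_at big_mkcond/= -big_split/= !normr_prod; apply: ler_prod => i _.
rewrite normr_ge0/= /y ltnNge; case: (leqP k i) => ki /=; last first.
  by have := h i; rewrite ki => /eqP ->; rewrite mul1r eqxx.
have [->|c0] := eqVneq (c (s i) (m i)) 0; first by rewrite !mul0r.
have [sm _] := c_neq0 c0.
have em : (e i <= m i)%N by apply: leq_trans sm; rewrite leq_addl.
rewrite -mulrA normrM [leRHS]normrM ler_wpM2l//.
set A := (_ * _)%N; set B := (_ * _)%N.
rewrite expr_div_n mulrC normrM [leRHS]normrM ler_wpM2l// -exprM.
rewrite ger0_norm ?divr_ge0 ?exprn_ge0 ?(ltW q_gt0)//.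
rewrite ger0_norm ?invr_ge0 ?exprn_ge0 ?(ltW q_gt0)//.
apply: (@le_trans _ _ (q ^+ B)^-1).
  by rewrite ler_piMl ?invr_ge0 ?exprn_ge0 ?exprn_ile1 ?ltW.
rewrite lef_pV2 ?posrE ?exprn_gt0//.
by rewrite ler_wiXn2l ?ltW// leq_mul2l leq_subr orbT.
Qed.

(** Besides the moment, integrating the variable [j] leaves [q^j] from [gam j] and [q^(j e_j)] from
    the denominator [q^(j (m_j - e_j))], whose part [q^(j m_j)] goes into the argument [yv]. *)
Let K (k : nat) : C :=
  \prod_(j < n | (j < k)%N) (gauss_moment q (s j) * q ^+ (j + j * e j)).

Let phi (k : nat) (m : mexp n) : C := K k * beta k m.

Let phi0 : phi 0 = f.
Proof.
by apply/funext => m; rewrite /phi /K beta0 big1 ?mul1r.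
Qed.

Let G (k : nat) (z : 'rV[C]_n) : C := tsum (fun m => phi k m * monom_at z m).

Let absbounded_phi k z : absbounded (fun m => phi k m * monom_at z m).
Proof.
have := absboundedZ (K k) (absbounded_beta k z); congr absbounded.
by apply/funext => m; rewrite mulrA.
Qed.

Let entire_phi k : entire_series (phi k) (G k).
Proof.
move=> z; apply/abs_sumP; split; first exact: absbounded_phi.
exact/(tsumP sum_complete)/absbounded_phi.
Qed.

Let KS (l : 'I_n) : K l.+1 = K l * (gauss_moment q (s l) * q ^+ (l + l * e l)).
Proof.
rewrite /K (bigD1 l)//= mulrC; congr (_ * _); apply: eq_bigl => j.
by rewrite ltnS andbC -val_eqE/= -ltn_neqAle.
Qed.

Let beta_zero k (m : mexp n) (i : 'I_n) : (i < k)%N -> m i != 0%N -> beta k m = 0.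
Proof.
move=> ik mi; rewrite /beta ifF//; apply/negP => /forallP/(_ i).
by rewrite ik (negPf mi).
Qed.

Let series_in_phi (k : 'I_n) :
  series_in (~: [set (1%g : 'S_n) j | j : 'I_n & (j <= k)%N]) (phi k.+1).
Proof.
move=> m i; rewrite inE negbK => /imsetP[j]; rewrite inE perm1 => jk -> mj.
by rewrite /phi (beta_zero (i := j)) ?mulr0.
Qed.

Section Step.
Hypothesis s_even : forall i, ~~ odd (s i).
Variable l : 'I_n.

Let beta_supp k m (i : 'I_n) : beta k m != 0 -> (k <= i)%N ->
  (s i <= m i)%N /\ ~~ odd (m i - s i).
Proof.
rewrite /beta; case: ifP => [_|]; last by rewrite eqxx.
move=> /prodf_neq0 h ki; have := h i ki; rewrite mulf_eq0 negb_or => /andP[ci _].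
exact: c_neq0 ci.
Qed.

Let even_part_phi : even_part (phi l) = phi l.
Proof.
apply/funext => m; rewrite /even_part; case: ifPn => // /forallPn[i' mi].
move: i' mi => i; rewrite negbK => mi.
apply/esym; rewrite /phi; have [->|b0] := eqVneq (beta l m) 0; first by rewrite mulr0.
have [il|li] := ltnP i l.
  by rewrite (beta_zero il) ?mulr0//; apply: contraTneq mi => ->.
have [sm] := beta_supp b0 li; rewrite oddB// mi => so.
by move: so; rewrite addTb negbK (negPf (s_even i)).
Qed.

Let A : nat := \sum_(j < n | (l < j)%N) a j.

(* [yv x m = +- q^(2 (h + Sh m))] for [x = (h, _)]: the exponents [m] of the remaining
   variables only shift the lattice of the variable [l]. *)
Let Sh (m : mexp n) : nat := \sum_(i < n | (l < i)%N) (m i - e i + a i)./2.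

(** On the support [m_i - e_i] has the parity of [a_i]. Adding the [a_i] through [gam l] makes the
    total exponent even, which puts the argument back on the lattice of powers of [q^2]. *)
Let ShE m : beta l.+1 m != 0 -> (D l m + A = (Sh m).*2)%N.
Proof.
move=> b0; rewrite /D /A /Sh -big_split/= -mul2n big_distrr/=; apply: eq_bigr => i li.
have [sm ev] := beta_supp b0 li; rewrite mul2n -[LHS]odd_double_half.
have -> : (m i - e i + a i = (m i - s i) + (a i).*2)%N by rewrite /s in sm *; lia.
by rewrite oddD odd_double (negPf ev).
Qed.

Let wl (x : int * bool) : C := (-1) ^+ x.2 * q ^ (2 * x.1) * gam l.
Let kap z (m : mexp n) : C :=
  K l * beta l.+1 m * monom_at z m * q ^+ D l m * q ^+ (l * e l).
Let yv x (m : mexp n) : C := q ^+ D l m / q ^+ l * wl x.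

(** The series at a lattice point with the exponent of [l] split off as [mt.2]; for fixed [mt.1] the
    sum over [mt.2] is Euler's product at [yv x mt.1]. *)
Let Y z x (mt : mexp n * nat) : C := kap z mt.1 * (c (s l) mt.2 * yv x mt.1 ^+ mt.2).

Let D_eset t m : D l (eset l t m) = D l m.
Proof.
apply: eq_bigr => i li; rewrite ffunE; case: eqP => // iE.
by rewrite iE ltnn in li.
Qed.

Let YE z x m : Y z x (eset l 0 m, m l) =
  phi l m * monom_at (lattice_point q gam l z x) m.
Proof.
rewrite /Y /kap/= /phi beta_succ D_eset /yv D_eset.
have [->|b0] := eqVneq (beta l.+1 (eset l 0 m)) 0; first by rewrite !(mulr0, mul0r).
have [->|c0] := eqVneq (c (s l) (m l)) 0; first by rewrite !(mulr0, mul0r).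
have [sm _] := c_neq0 c0.
have el : (e l <= m l)%N by apply: leq_trans sm; rewrite leq_addl.
have -> : monom_at (lattice_point q gam l z x) m = wl x ^+ m l * monom_at z (eset l 0 m).
  rewrite /monom_at (bigD1 l)//= [X in _ = _ * X](bigD1 l)//= ffunE eqxx expr0 mul1r.
  rewrite mxE ltnn eqxx; congr (_ * _); apply: eq_bigr => i il.
  rewrite mxE ffunE (negPf il); case: ltnP => // li.
  suff -> : m i = 0%N by rewrite !expr0.
  apply/eqP/negPn/negP => mi; case/eqP: b0; apply: (beta_zero (i := i)) => //.
    by rewrite ltnS ltnW.
  by rewrite ffunE (negPf il).
have -> : q ^+ (l * (m l - e l)) = q ^+ (l * m l) / q ^+ (l * e l).
  by apply: (canRL (mulfK (qX_neq0 _))); rewrite -exprD -mulnDr subnK.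
rewrite !exprMn exprVn -!exprM mulSn exprD [(D l m * _)%N]mulnC; field.
by rewrite !qX_neq0.
Qed.

Let hassum_row z x m : hassum (fun t => Y z x (m, t))
  (kap z m * (yv x m ^+ s l * Etheta (q ^+ 4) (q ^+ 4 * yv x m ^+ 2))).
Proof. by have := hassumZ (kap z m) (hassum_c (s l) (yv x m)).1; exact. Qed.

Let hassum_rows z x : hassum
  (fun m => kap z m * (yv x m ^+ s l * Etheta (q ^+ 4) (q ^+ 4 * yv x m ^+ 2)))
  (G l (lattice_point q gam l z x)).
Proof.
have K1 : cancel (fun m : mexp n => (eset l 0 m, m l)) (fun mt => eset l mt.2 mt.1).
  by move=> m; apply/ffunP => i; rewrite !ffunE; case: eqP => // ->.
have Y0 mt : (eset l 0 (eset l mt.2 mt.1), (eset l mt.2 mt.1) l) != mt -> Y z x mt = 0.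
  case: mt => m t /= h; have [ml|ml] := eqVneq (m l) 0%N; last first.
    by rewrite /Y /kap (beta_zero (i := l)) ?(mulr0, mul0r).
  case/eqP: h; rewrite ffunE eqxx; congr (_, _); apply/ffunP => i; rewrite !ffunE.
  by case: eqP => // ->.
have h : hassum (Y z x) (G l (lattice_point q gam l z x)).
  apply/(hassum_reindex K1 Y0).
  rewrite (_ : _ \o _ = fun m => phi l m * monom_at (lattice_point q gam l z x) m).
    exact/(tsumP sum_complete)/absbounded_phi.
  by apply/funext => m /=; rewrite YE.
exact: hassum_fubini h (hassum_row z x).
Qed.

Let T z (mx : mexp n * (int * bool)) : C :=
  K l * q ^+ (l + l * e l) * (beta l.+1 mx.1 * monom_at z mx.1) *
  lattice_term q (s l) (mx.2.1 + (Sh mx.1)%:Z, mx.2.2).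

(** The measure shifts together with the argument: [q^(2 h)], the factor [q^(l + A)] of [gam l] and
    the [q^D] of [kap] combine to [q^(2 (h + Sh)) q^l], since [D + A = 2 Sh]. *)
Let TE z x m : (1 - q ^+ 2) * (q ^ (2 * x.1) * gam l *
    (kap z m * (yv x m ^+ s l * Etheta (q ^+ 4) (q ^+ 4 * yv x m ^+ 2)))) = T z (m, x).
Proof.
rewrite /T /kap/=; have [->|b0] := eqVneq (beta l.+1 m) 0; first by rewrite !(mulr0, mul0r).
have gE : gam l = q ^+ l * q ^+ A by rewrite /gam exprD.
have qE : q ^+ D l m * q ^+ A = q ^+ (Sh m).*2 by rewrite -exprD ShE.
have sE : q ^ (2 * (x.1 + (Sh m)%:Z)) = q ^ (2 * x.1) * q ^+ (Sh m).*2.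
  by rewrite mulrDr expfzDr// -mul2n -PoszM -exprnP.
rewrite /lattice_term /= sE.
have -> : (-1) ^+ x.2 * (q ^ (2 * x.1) * q ^+ (Sh m).*2) = yv x m.
  by rewrite /yv /wl gE -qE; field.
rewrite gE -qE exprD; ring.
Qed.

(** The family [T z] is summed in both orders. Lattice first, each exponent contributes a moment and
    the terms of [phi l.+1] appear; exponents first, the values of [G l] at the lattice points
    appear. *)
Lemma lattice_integral_phi : is_lattice_integral q gam l (phi l) (G l.+1).
Proof.
move=> z; exists (fun x => G l (lattice_point q gam l z x)) => [x|].
  by rewrite even_part_phi; exact: extended_value_entire.
have rows m : hassum (fun x => T z (m, x)) (phi l.+1 m * monom_at z m).
  have := hassumZ (K l * q ^+ (l + l * e l) * (beta l.+1 m * monom_at z m))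
    (lattice_term_shift sum_complete q_gt0 q_lt1 (Sh m)%:Z (s_even l)).1.
  by congr (hassum _ _); rewrite /phi KS; ring.
have Tb : absbounded (T z).
  have [M hM] := (lattice_term_shift sum_complete q_gt0 q_lt1 0 (s_even l)).2.
  have M0 : 0 <= M by have := hM 0 fset0; rewrite big_seq_fset0.
  apply: (@absbounded_prod _ _ _ _ (fun m =>
    K l * q ^+ (l + l * e l) * M * (beta l.+1 m * monom_at z m))).
    exact/absboundedZ/absbounded_beta.
  move=> m J; rewrite (_ : \sum_(x <- J) _ =
      `|K l * q ^+ (l + l * e l) * (beta l.+1 m * monom_at z m)| *
      \sum_(x <- J) `|lattice_term q (s l) (x.1 + (Sh m)%:Z, x.2)|); last first.
    by rewrite mulr_sumr; apply: eq_bigr => x _; rewrite -normrM.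
  by rewrite [X in _ <= `|X|]mulrAC [leRHS]normrM (ger0_norm M0) ler_wpM2l.
have cols x : hassum (fun m => T z (m, x)) ((1 - q ^+ 2) *
    (q ^ (2 * x.1) * gam l * G l (lattice_point q gam l z x))).
  have := hassumZ (1 - q ^+ 2) (hassumZ (q ^ (2 * x.1) * gam l) (hassum_rows z x)).
  by congr (hassum _ _); apply/funext => m; rewrite TE.
have [S hS] := sum_complete Tb.
have SE : S = G l.+1 z.
  apply: hassum_unique (hassum_fubini hS rows) _.
  exact/(tsumP sum_complete)/absbounded_phi.
have swK : cancel (fun xm : (int * bool) * mexp n => (xm.2, xm.1)) (fun mx => (mx.2, mx.1)).
  by case.
have sw0 k : ((k.2, k.1).2, (k.2, k.1).1) != k -> T z k = 0 by case: k => m x /eqP.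
apply/abs_sumP; rewrite -SE; split.
  exact: absbounded_fubini ((absbounded_reindex swK sw0).1 Tb) cols.
exact: hassum_fubini ((hassum_reindex swK sw0 S).1 hS) cols.
Qed.

End Step.

Let entire_zero : entire_series (fun _ : mexp n => 0 : C) (fun=> 0).
Proof.
move=> z; apply/abs_sumP; rewrite (_ : (fun m => _) = fun=> 0); last first.
  by apply/funext => m; rewrite mul0r.
split; last exact: hassum0.
by apply: (@absbounded_fin C _ _ fset0).
Qed.

Lemma lattice_value_gauss : lattice_value q 1%g gam f
  (\prod_j if odd (s j) then 0 else gauss_moment q (s j) * q ^+ (j + j * e j)).
Proof.
have near0 : \forall z \near (0 : 'rV[C]_n), exists v, psum_at f z v.
  by apply/near_rowP; exists 1 => // z _; exists (G 0 z); rewrite -phi0; exact: entire_phi.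
have [/existsP[k ks]|] := boolP [exists k, odd (s k)].
  (* Every monomial in the support of [f] has an exponent of the parity of [s k], hence odd, in the
     variable [k]. The even part of [f] is therefore zero, and so is the chain from the first
     integration on. *)
  exists (fun k => if k == 0%N then f else fun=> 0); split=> //; last first.
    rewrite (bigD1 k)//= ks mul0r; case: eqP => // n0.
    by move/eqP: n0; rewrite -leqn0 leqNgt (leq_ltn_trans _ (ltn_ord k)).
  split=> // j; split=> //; exists (fun=> 0); last exact: entire_zero.
  have ev0 : even_part (if nat_of_ord j == 0%N then f else fun=> 0) = fun=> 0.
    case: eqP => _; apply/funext => m; rewrite /even_part; case: ifP => // /forallP ev.
    rewrite -phi0 /phi /beta ifT; last exact/forallP.
    rewrite [X in _ * X](bigD1 k)//=; have [->|c0] := eqVneq (c (s k) (m k)) 0.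
      by rewrite !mul0r mulr0.
    have [sm] := c_neq0 c0; rewrite oddB// ks => /negP[].
    by have := ev k; case: (odd _).
  move=> z; exists (fun=> 0) => [x|].
    by rewrite ev0; exact: (extended_value_entire sum_complete row_connected _ entire_zero).
  apply/abs_sumP; rewrite (_ : (fun p => _) = fun=> 0); last first.
    by apply/funext => x; rewrite !mulr0.
  split; last exact: hassum0.
  by apply: (@absbounded_fin C _ _ fset0).
rewrite negb_exists => /forallP s_even.
exists phi; split; first exact: phi0.
  split=> [|k]; first by rewrite phi0.
  split; first exact: series_in_phi.
  exists (G k.+1); last exact: entire_phi.
  by rewrite perm1; exact: lattice_integral_phi.
rewrite /phi /beta ifT; last by apply/forallP => i; rewrite ffunE implybT.
rewrite [X in _ * X]big1 => [|i]; last by rewrite leqNgt ltn_ord.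
rewrite mulr1 /K; apply: eq_big => j; first by rewrite ltn_ord.
by rewrite (negPf (s_even j)).
Qed.

End GaussianChain.

(** * Comparison of the coefficients of the transform with the Hermite product *)

Lemma weak_transform_coef (C : numClosedFieldType) n (q : C) (a : 'I_n -> nat) (e : mexp n) :
  0 < q -> q < 1 ->
  (\prod_j if odd (a j + e j) then 0 else
      gauss_moment q (a j + e j) * q ^+ (j + j * e j)) *
    ('i ^+ (\sum_(j < n) e j)%N * q ^- (\sum_(j < n) j * e j)%N
      / \prod_(j < n) qpoch (q ^+ 2) (q ^+ 2) (e j)) =
  q ^+ (\sum_(j < n) (a j ^ 2 - a j))%N * 'i ^+ (\sum_(j < n) a j)%N
    * b_const (q ^+ 2) ^+ n * q ^+ 'C(n, 2) * hermite_gauss_prod q a e.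
Proof.
move=> q0 q1; rewrite hermite_gauss_prodE -!prodrXr -!prodfV -!big_split/=.
have -> : b_const (q ^+ 2) ^+ n = \prod_(j < n) b_const (q ^+ 2).
  by rewrite prodr_const card_ord.
(* The factors [q^(j e_j)] of the integrals cancel against the weight of the transform; the
   remaining [q^j], with [j] counted from 0, multiply to [q^'C(n, 2)]. *)
have -> : q ^+ 'C(n, 2) = \prod_(j < n) q ^+ j.
  by rewrite prodrXr -(big_mkord xpredT id) bin2_sum.
rewrite -!big_split/=; apply: eq_bigr => j _.
have := hermite_moment (a j) (e j) q0 q1; set S := \sum_(_ < _) _ => H.
transitivity (b_const (q ^+ 2) * q ^+ j * (q ^+ (a j ^ 2 - a j) * 'i ^+ a j * S)); last by ring.
rewrite -H; case: ifP => _; first by rewrite !(mul0r, mulr0).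
have Q0 : qpoch (q ^+ 2) (q ^+ 2) (e j) != 0.
  by rewrite gt_eqF// qpochpp_gt0 ?exprn_gt0// exprn_ilt1// ltW.
rewrite /gauss_moment exprD; field.
by rewrite Q0 expf_neq0 ?gt_eqF.
Qed.

Theorem mainTheorem3 (R : realType) (n : nat) (q : R) (a : 'I_n -> nat)
    (q_gt0 : 0 < q) (q_lt1 : q < 1) (n_ge1 : (1 <= n)%N) :
  let qC : R[i] := (q%:C)%C in
  let gam : 'I_n -> R[i] :=
    fun k => qC ^+ (k + \sum_(j < n | (k < j)%N) a j)%N in
  let N := gaussN qC a in
  weak_transform_defined qC 1%g gam N /\
  weak_transform qC 1%g gam N
  = (fun e =>
       qC ^+ (\sum_(j < n) (a j ^ 2 - a j))%N * 'i ^+ (\sum_(j < n) a j)%N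
       * b_const (qC ^+ 2) ^+ n * qC ^+ 'C(n, 2)
       * hermite_gauss_prod qC a e).
Proof.
move=> qC gam N; pose C : numClosedFieldType := R[i].
have q0 : 0 < (qC : C) by rewrite ltcR.
have q1 : (qC : C) < 1 by rewrite ltcR.
have val e := lattice_value_gauss (@absbounded_hassum R) (@connected_row_setT R n) a e q0 q1.
split; first by move=> e; exists (\prod_j if odd (a j + e j) then 0 else
  gauss_moment (qC : C) (a j + e j) * qC ^+ (j + j * e j)); exact: val.
apply/funext => e; rewrite /weak_transform (lattice_intE (val e)).
exact: weak_transform_coef q0 q1.
Qed.
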